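(* Let $S$ be an object of $\mathcal X$. Every sheaf of groups on $\mathcal X/S$ which is representable by a scheme of finite type $G$ over $S$ is a presentable group sheaf over $S$.
   Context: $k$ is a noetherian ring; $\mathcal X$ is the big étale site of noetherian schemes over $k$; for $S\in\mathcal X$, $\mathcal X/S$ is the site of schemes in $\mathcal X$ over $S$ with the étale topology. Schemes over $S$ are identified with the sheaves they represent. ''Surjective'' means surjective as a morphism of étale sheaves. A morphism $a:\mathcal F\to\mathcal G$ of sheaves on $\mathcal X/S$ is ($S$-)vertical if for all $n\ge 1$ the following lifting property holds. Let $Y$ be a scheme over $S$ with $n$ closed subschemes $Y_1,\dots,Y_n\subset Y$ and retractions $r_i:Y\to Y_i$ over $S$ which commute pairwise ($r_ir_j=r_jr_i$) and such that for $j\le i$, $r_i$ maps $Y_j$ to $Y_j\cap Y_i$. Suppose given a morphism $Y\to\mathcal G$ and liftings $\lambda_i:Y_i\to\mathcal F$ of the restrictions $Y_i\to\mathcal G$ with $\lambda_i|_{Y_i\cap Y_j}=\lambda_j|_{Y_i\cap Y_j}$. Then for any $P\in Y$ lying on at least one of the $Y_i$ there are an étale neighborhood $P\in Y'\to Y$ and a lifting $\lambda:Y'\to\mathcal F$ of $Y'\to\mathcal G$ agreeing with $\lambda_i|_{Y_i\times_YY'}$ on $Y_i\times_YY'$ for all $i$. A sheaf $\mathcal F$ on $\mathcal X/S$ is $P4$ if there are surjective vertical morphisms $X\to\mathcal F$ and $R\to X\times_{\mathcal F}X$ with $X,R$ affine schemes of finite type over $S$; it is $P5$ if it is $P4$ and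 the structural morphism $\mathcal F\to S$ is vertical. A sheaf of groups on $\mathcal X/S$ is a presentable group sheaf if its underlying sheaf is $P5$. *)

(* Defs.v *)
(* The notations of mpoly clash with those of topology, so the ring of         *)
(* polynomials in n variables over R is written mpoly n R.                     *)
From HB Require Import structures.
From mathcomp Require Import -(notations) mpoly.
From mathcomp Require Import all_boot all_order all_algebra generic_quotient ring.
From mathcomp Require Import boolp classical_sets topology.

Set Implicit Arguments.
Unset Strict Implicit.
Unset Printing Implicit Defensive.

Import GRing.Theory.

Local Open Scope quotient_scope.
Local Open Scope classical_set_scope.
Local Open Scope ring_scope.

Definition invertible (A : comPzRingType) (a : A) : Prop := exists b, a * b = 1.

Record is_ideal (A : comPzRingType) (I : set A) : Prop := IsIdeal {
  ideal0 : I 0;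
  idealD : forall a b, I a -> I b -> I (a + b);
  idealM : forall a b, I b -> I (a * b)
}.

Definition fin_gen (A : comPzRingType) (I : set A) : Prop :=
  exists s : seq A, I = [set a | exists c : nat -> A,
                                 a = \sum_(i < size s) c i * s`_i].

Definition noetherian_ring (A : comPzRingType) : Prop :=
  forall I : set A, is_ideal I -> fin_gen I.

Definition local_ring (A : comNzRingType) : Prop :=
  is_ideal [set a : A | ~ invertible a].

Definition finite_type_ring (R A : comNzRingType) (phi : {rmorphism R -> A}) :
    Prop :=
  exists (n : nat) (h : {rmorphism mpoly n R -> A}),
    (forall c, h (mpolyC n c) = phi c) /\ (forall a, exists q, h q = a).

Definition finite_presentation_ring (R A : comNzRingType)
    (phi : {rmorphism R -> A}) : Prop :=
  exists (n : nat) (h : {rmorphism mpoly n R -> A}),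
    [/\ forall c, h (mpolyC n c) = phi c,
        forall a, exists q, h q = a
      & fin_gen [set q | h q = 0]].

Record prime_ideal (A : comPzRingType) : Type := PrimeIdeal {
  prime_set :> A -> Prop;
  prime_is_ideal : is_ideal prime_set;
  prime_proper : ~ prime_set 1;
  primeP : forall a b, prime_set (a * b) -> prime_set a \/ prime_set b
}.

HB.instance Definition _ (A : comPzRingType) := gen_eqMixin (prime_ideal A).
HB.instance Definition _ (A : comPzRingType) := gen_choiceMixin (prime_ideal A).

Section Localization.
Variables (A : comPzRingType) (p : prime_ideal A).

Record prefrac : Type := Prefrac {
  pnum : A;
  pden : A;
  pdenP : ~ p pden
}.
Arguments pdenP : clear implicits.

HB.instance Definition _ := gen_eqMixin prefrac.
HB.instance Definition _ := gen_choiceMixin prefrac.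

Definition frac_rel (x y : prefrac) : bool :=
  `[< exists2 u, ~ p u & u * (pnum x * pden y) = u * (pnum y * pden x) >].

Lemma prime_mulN a b : ~ p a -> ~ p b -> ~ p (a * b).
Proof. by move=> pa pb /primeP[]. Qed.

Lemma frac_rel_refl : reflexive frac_rel.
Proof. by move=> x; apply/asboolP; exists 1 => //; exact: prime_proper. Qed.

Lemma frac_rel_sym : symmetric frac_rel.
Proof. by move=> x y; apply/asboolP/asboolP => -[u pu e]; exists u. Qed.

Lemma frac_rel_trans : transitive frac_rel.
Proof.
move=> y x z /asboolP[u pu e] /asboolP[v pv f]; apply/asboolP.
exists (u * v * pden y); first by do 2?apply: prime_mulN => //; exact: (pdenP y).
transitivity (v * pden z * (u * (pnum x * pden y))); first by ring.
rewrite e; transitivity (u * pden x * (v * (pnum y * pden z))); first by ring.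
by rewrite f; ring.
Qed.

Canonical frac_equiv := EquivRel frac_rel frac_rel_refl frac_rel_sym frac_rel_trans.

Definition localization := {eq_quot frac_equiv}.
HB.instance Definition _ := Choice.on localization.
HB.instance Definition _ := EqQuotient.on localization.

Definition frac (a s : A) (ps : ~ p s) : localization := \pi_localization (Prefrac a ps).

Lemma fracP (x : localization) : exists a s (ps : ~ p s), x = frac a ps.
Proof. by elim/quotW: x => -[a s ps]; exists a, s, ps. Qed.

Lemma frac_eq a s (ps : ~ p s) b t (pt : ~ p t) :
  frac a ps = frac b pt <-> exists2 u, ~ p u & u * (a * t) = u * (b * s).
Proof.
split; first by move=> /eqmodP /asboolP.
by move=> h; apply/eqmodP/asboolP.
Qed.

Definition loc_zero := frac 0 (@prime_proper _ p).
Definition loc_one := frac 1 (@prime_proper _ p).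
Definition loc_opp (x : localization) : localization :=
  frac (- pnum (repr x)) (pdenP (repr x)).
Definition loc_add (x y : localization) : localization :=
  frac (pnum (repr x) * pden (repr y) + pnum (repr y) * pden (repr x))
       (prime_mulN (pdenP (repr x)) (pdenP (repr y))).
Definition loc_mul (x y : localization) : localization :=
  frac (pnum (repr x) * pnum (repr y))
       (prime_mulN (pdenP (repr x)) (pdenP (repr y))).

Lemma repr_frac a s (ps : ~ p s) :
  exists2 u, ~ p u &
    u * (pnum (repr (frac a ps)) * s) = u * (a * pden (repr (frac a ps))).
Proof.
set r := repr _; apply/(frac_eq _ (pdenP r)).
by rewrite -[RHS]reprK -/r; case: (r).
Qed.

Lemma loc_oppE a s (ps : ~ p s) : loc_opp (frac a ps) = frac (- a) ps.
Proof.
apply/frac_eq; have [u pu e] := repr_frac a ps; exists u => //.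
by rewrite !mulNr !mulrN e.
Qed.

Lemma loc_addE a s (ps : ~ p s) b t (pt : ~ p t) :
  loc_add (frac a ps) (frac b pt) = frac (a * t + b * s) (prime_mulN ps pt).
Proof.
apply/frac_eq; have [u pu] := repr_frac a ps; have [v pv] := repr_frac b pt.
case: (repr (frac a ps)) => a' s' ps'; case: (repr (frac b pt)) => b' t' pt' /=.
move=> f e; exists (u * v); first exact: prime_mulN.
transitivity (v * t * t' * (u * (a' * s)) + u * s * s' * (v * (b' * t))).
  by ring.
by rewrite e f; ring.
Qed.

Lemma loc_mulE a s (ps : ~ p s) b t (pt : ~ p t) :
  loc_mul (frac a ps) (frac b pt) = frac (a * b) (prime_mulN ps pt).
Proof.
apply/frac_eq; have [u pu] := repr_frac a ps; have [v pv] := repr_frac b pt.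
case: (repr (frac a ps)) => a' s' ps'; case: (repr (frac b pt)) => b' t' pt' /=.
move=> f e; exists (u * v); first exact: prime_mulN.
transitivity ((u * (a' * s)) * (v * (b' * t))); first by ring.
by rewrite e f; ring.
Qed.

Lemma frac_eqW a s (ps : ~ p s) b t (pt : ~ p t) :
  a * t = b * s -> frac a ps = frac b pt.
Proof.
by move=> e; apply/frac_eq; exists 1; [exact: prime_proper | rewrite e].
Qed.

Lemma loc_addA : associative loc_add.
Proof.
move=> x y z; have [a [s [ps ->]]] := fracP x; have [b [t [pt ->]]] := fracP y.
have [c [r [pr ->]]] := fracP z; rewrite !loc_addE; apply: frac_eqW; ring.
Qed.

Lemma loc_addC : commutative loc_add.
Proof.
move=> x y; have [a [s [ps ->]]] := fracP x; have [b [t [pt ->]]] := fracP y.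
by rewrite !loc_addE; apply: frac_eqW; ring.
Qed.

Lemma loc_add0 : left_id loc_zero loc_add.
Proof.
move=> x; have [a [s [ps ->]]] := fracP x.
by rewrite loc_addE; apply: frac_eqW; ring.
Qed.

Lemma loc_addN : left_inverse loc_zero loc_opp loc_add.
Proof.
move=> x; have [a [s [ps ->]]] := fracP x.
by rewrite loc_oppE loc_addE; apply: frac_eqW; ring.
Qed.

Lemma loc_mulA : associative loc_mul.
Proof.
move=> x y z; have [a [s [ps ->]]] := fracP x; have [b [t [pt ->]]] := fracP y.
have [c [r [pr ->]]] := fracP z; rewrite !loc_mulE; apply: frac_eqW; ring.
Qed.

Lemma loc_mulC : commutative loc_mul.
Proof.
move=> x y; have [a [s [ps ->]]] := fracP x; have [b [t [pt ->]]] := fracP y.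
by rewrite !loc_mulE; apply: frac_eqW; ring.
Qed.

Lemma loc_mul1 : left_id loc_one loc_mul.
Proof.
move=> x; have [a [s [ps ->]]] := fracP x.
by rewrite loc_mulE; apply: frac_eqW; ring.
Qed.

Lemma loc_mulD : left_distributive loc_mul loc_add.
Proof.
move=> x y z; have [a [s [ps ->]]] := fracP x; have [b [t [pt ->]]] := fracP y.
have [c [r [pr ->]]] := fracP z; rewrite !(loc_mulE, loc_addE).
by apply: frac_eqW; ring.
Qed.

Lemma loc_1neq0 : loc_one != loc_zero.
Proof.
apply/eqP => /frac_eq[u pu]; rewrite !mulr1 mulr0 => u0.
by apply: pu; rewrite u0; exact: ideal0 (prime_is_ideal p).
Qed.

HB.instance Definition _ := GRing.isZmodule.Build localization
  loc_addA loc_addC loc_add0 loc_addN.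
HB.instance Definition _ := GRing.Zmodule_isComNzRing.Build localization
  loc_mulA loc_mulC loc_mul1 loc_mulD loc_1neq0.

Definition to_loc (a : A) : localization := frac a (@prime_proper _ p).

Lemma frac_invertible a s (ps : ~ p s) :
  invertible (frac a ps) <-> ~ p a.
Proof.
have pI := prime_is_ideal p; split.
  move=> [x]; have [b [t [pt ->]]] := fracP x => /esym.
  rewrite [RHS]loc_mulE => /frac_eq[u pu]; rewrite mul1r mulr1 => e pa.
  apply: (prime_mulN pu (prime_mulN ps pt)); rewrite e.
  by apply: idealM => //; rewrite mulrC; apply: idealM.
move=> pa; exists (frac s pa); rewrite [LHS]loc_mulE.
by apply: frac_eqW; ring.
Qed.

Lemma localization_local : local_ring localization.
Proof.
have pI := prime_is_ideal p; split => /=.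
- by move=> /frac_invertible; apply; exact: ideal0.
- move=> x y; have [a [s [ps ->]]] := fracP x; have [b [t [pt ->]]] := fracP y.
  move=> /frac_invertible/contrapT pa /frac_invertible/contrapT pb.
  rewrite [_ + _]loc_addE => /frac_invertible; apply.
  by apply: (idealD pI); rewrite mulrC; apply: (idealM pI).
- move=> x y; have [a [s [ps ->]]] := fracP x; have [b [t [pt ->]]] := fracP y.
  move=> /frac_invertible/contrapT pb.
  by rewrite [_ * _]loc_mulE => /frac_invertible; apply; apply: idealM.
Qed.

End Localization.

Record category : Type := Category {
  obj :> Type;
  hom : obj -> obj -> Type;
  idm : forall x, hom x x;
  cmp : forall x y z, hom y z -> hom x y -> hom x z;
  cmp1m : forall x y (f : hom x y), cmp (idm y) f = f;
  cmpm1 : forall x y (f : hom x y), cmp f (idm x) = f;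
  cmpA : forall x y z t (f : hom z t) (g : hom y z) (h : hom x y),
    cmp f (cmp g h) = cmp (cmp f g) h
}.
Arguments idm {c} x.

Notation "g \oc f" := (cmp g f) (at level 50, left associativity).

Definition isomorphic (C : category) (X Y : C) : Prop :=
  exists (f : hom X Y) (g : hom Y X), g \oc f = idm X /\ f \oc g = idm Y.

Section FullSubcategory.
Variables (C : category) (P : C -> Prop).

Record full_obj : Type := FullObj { full_val :> C; full_valP : P full_val }.

Definition full : category := @Category full_obj
  (fun X Y => hom X Y) (fun X => idm X) (fun X Y Z g f => g \oc f)
  (fun X Y f => cmp1m f) (fun X Y f => cmpm1 f)
  (fun X Y Z T f g h => cmpA f g h).

End FullSubcategory.

Section Slice.
Variables (C : category) (S : C).

Record over : Type := Over { dom :> C; str : hom dom S }.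

Record over_hom (X Y : over) : Type := OverHom {
  over_fun :> hom X Y;
  over_comm : str Y \oc over_fun = str X
}.

Lemma over_homP (X Y : over) (f g : over_hom X Y) :
  over_fun f = over_fun g -> f = g.
Proof.
case: f g => [f fP] [g gP] /= e; case: _ / e gP => gP.
by congr OverHom; exact: Prop_irrelevance.
Qed.

Definition over_id (X : over) : over_hom X X := OverHom (cmpm1 (str X)).

Lemma over_cmp_subproof (X Y Z : over) (g : over_hom Y Z) (f : over_hom X Y) :
  str Z \oc (over_fun g \oc over_fun f) = str X.
Proof. by rewrite cmpA !over_comm. Qed.

Definition over_cmp (X Y Z : over) (g : over_hom Y Z) (f : over_hom X Y) :
  over_hom X Z := OverHom (over_cmp_subproof g f).

Lemma over_cmp1m (X Y : over) (f : over_hom X Y) : over_cmp (over_id Y) f = f.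
Proof. by apply: over_homP; exact: cmp1m. Qed.

Lemma over_cmpm1 (X Y : over) (f : over_hom X Y) : over_cmp f (over_id X) = f.
Proof. by apply: over_homP; exact: cmpm1. Qed.

Lemma over_cmpA (X Y Z T : over) (f : over_hom Z T) (g : over_hom Y Z)
    (h : over_hom X Y) : over_cmp f (over_cmp g h) = over_cmp (over_cmp f g) h.
Proof. by apply: over_homP; exact: cmpA. Qed.

Definition slice : category := Category over_cmp1m over_cmpm1 over_cmpA.

Definition slice_base : slice := Over (idm S).

Definition to_slice_base (X : slice) : hom X slice_base :=
  @OverHom X slice_base (str X) (cmp1m (str X)).

Lemma to_slice_base_unique (X : slice) (f : hom X slice_base) :
  f = to_slice_base X.
Proof. by apply: over_homP; rewrite /= -(over_comm f) /= cmp1m. Qed.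

End Slice.

Record presheaf (C : category) : Type := Presheaf {
  psh_obj :> C -> Type;
  res : forall U V : C, hom U V -> psh_obj V -> psh_obj U;
  res_id : forall U (s : psh_obj U), res (idm U) s = s;
  res_cmp : forall U V W (g : hom V W) (f : hom U V) (s : psh_obj W),
    res (g \oc f) s = res f (res g s)
}.
Arguments res {C} p {U V}.

Record psh_hom (C : category) (F G : presheaf C) : Type := PshHom {
  psh_app :> forall U : C, F U -> G U;
  psh_nat : forall (U V : C) (f : hom U V) (s : F V),
    psh_app (res F f s) = res G f (psh_app s)
}.
Arguments psh_app {C F G} p U s.

Definition yoneda (C : category) (X : C) : presheaf C := @Presheaf C
  (fun U => hom U X) (fun U V f s => s \oc f)
  (fun U s => cmpm1 s) (fun U V W g f s => cmpA s g f).

Definition represented_by (C : category) (F : presheaf C) (X : C) : Prop :=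
  exists (a : psh_hom (yoneda X) F) (b : psh_hom F (yoneda X)),
    (forall U (s : yoneda X U), b U (a U s) = s) /\
    (forall U (s : F U), a U (b U s) = s).

Section FibreProduct.
Variables (C : category) (F G H : presheaf C).
Variables (a : psh_hom F H) (b : psh_hom G H).

Record fibre_obj (U : C) : Type := Fibre {
  fib1 : F U;
  fib2 : G U;
  fibP : a U fib1 = b U fib2
}.

Lemma fibre_eq (U : C) (s t : fibre_obj U) :
  fib1 s = fib1 t -> fib2 s = fib2 t -> s = t.
Proof.
case: s t => [s1 s2 sP] [t1 t2 tP] /= e1 e2.
case: _ / e1 tP => tP; case: _ / e2 tP => tP.
by congr Fibre; exact: Prop_irrelevance.
Qed.

Lemma fibre_res_subproof (U V : C) (f : hom U V) (s : fibre_obj V) :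
  a U (res F f (fib1 s)) = b U (res G f (fib2 s)).
Proof. by rewrite !psh_nat fibP. Qed.

Definition fibre_res (U V : C) (f : hom U V) (s : fibre_obj V) : fibre_obj U :=
  Fibre (fibre_res_subproof f s).

Lemma fibre_res_id (U : C) (s : fibre_obj U) : fibre_res (idm U) s = s.
Proof. by apply: fibre_eq; exact: res_id. Qed.

Lemma fibre_res_cmp (U V W : C) (g : hom V W) (f : hom U V) (s : fibre_obj W) :
  fibre_res (g \oc f) s = fibre_res f (fibre_res g s).
Proof. by apply: fibre_eq; exact: res_cmp. Qed.

Definition fibre_product : presheaf C := Presheaf fibre_res_id fibre_res_cmp.

End FibreProduct.

(* The structure sheaf is given as an etale space: its stalks, together with   *)
(* the families of germs that are sections over an open set U. A family is     *)
(* written as a total function, of which only the values on U matter.          *)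
Record lrs : Type := LRS {
  space :> topologicalType;
  stalk : space -> comNzRingType;
  section : set space -> (forall x, stalk x) -> Prop;
  section_sheaf : forall (U : set space) (s : forall x, stalk x), open U ->
    (forall x, U x -> exists V t, [/\ open V, V x, section V t
                               & forall y, U y -> V y -> s y = t y]) ->
    section U s;
  section1 : forall U, open U -> section U (fun=> 1);
  sectionB : forall U s t, open U -> section U s -> section U t ->
    section U (fun x => s x - t x);
  sectionM : forall U s t, open U -> section U s -> section U t ->
    section U (fun x => s x * t x);
  germ_surj : forall x (a : stalk x), exists U s,
    [/\ open U, U x, section U s & s x = a];
  germ_inj : forall U s t x, open U -> U x -> section U s -> section U t ->
    s x = t x -> exists V, [/\ open V, V x & forall y, V y -> s y = t y];
  stalk_local : forall x, local_ring (stalk x)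
}.
Arguments section : clear implicits.
Arguments stalk : clear implicits.

Record lrs_hom (X Y : lrs) : Type := LRSHom {
  lrs_fun :> X -> Y;
  comap : forall x, {rmorphism stalk Y (lrs_fun x) -> stalk X x};
  lrs_continuous : forall V : set Y, open V -> open (lrs_fun @^-1` V);
  comap_section : forall (V : set Y) s, open V -> section Y V s ->
    section X (lrs_fun @^-1` V) (fun x => comap x (s (lrs_fun x)));
  comap_local : forall x a, invertible (comap x a) -> invertible a
}.
Arguments comap {X Y} l x.

Lemma rmorphism_eq (R S : comNzRingType) (f g : {rmorphism R -> S}) :
  (f : R -> S) = g -> f = g.
Proof.
case: f g => [f [[fD] [fM]]] [g [[gD] [gM]]] /= e.
case: _ / e gD gM => gD gM.
by rewrite (Prop_irrelevance fD gD) (Prop_irrelevance fM gM).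
Qed.

Lemma lrs_hom_eq (X Y : lrs) (f : X -> Y)
    (c d : forall x, {rmorphism stalk Y (f x) -> stalk X x}) pf1 pf2 pf3 pg1 pg2 pg3 :
  (forall x a, c x a = d x a) ->
  @LRSHom X Y f c pf1 pf2 pf3 = @LRSHom X Y f d pg1 pg2 pg3.
Proof.
move=> cd; have e : c = d.
  by apply: functional_extensionality_dep => x; apply: rmorphism_eq; exact/funext/cd.
case: _ / e pg1 pg2 pg3 {cd} => pg1 pg2 pg3.
rewrite (Prop_irrelevance pf1 pg1) (Prop_irrelevance pf2 pg2).
by rewrite (Prop_irrelevance pf3 pg3).
Qed.

Definition lrs_id (X : lrs) : lrs_hom X X :=
  @LRSHom X X (fun x => x) (fun x => idfun)
    (fun V oV => oV) (fun V s oV sV => sV) (fun x a ia => ia).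

Definition lrs_cmp (X Y Z : lrs) (g : lrs_hom Y Z) (f : lrs_hom X Y) :
    lrs_hom X Z :=
  @LRSHom X Z (fun x => g (f x)) (fun x => comap f x \o comap g (f x))
    (fun V oV => lrs_continuous f (lrs_continuous g oV))
    (fun V s oV sV => comap_section f (lrs_continuous g oV)
                        (comap_section g oV sV))
    (fun x a ia => comap_local (comap_local ia)).

Lemma lrs_cmp1m (X Y : lrs) (f : lrs_hom X Y) : lrs_cmp (lrs_id Y) f = f.
Proof. by case: f => *; exact: lrs_hom_eq. Qed.

Lemma lrs_cmpm1 (X Y : lrs) (f : lrs_hom X Y) : lrs_cmp f (lrs_id X) = f.
Proof. by case: f => *; exact: lrs_hom_eq. Qed.

Lemma lrs_cmpA (X Y Z T : lrs) (f : lrs_hom Z T) (g : lrs_hom Y Z)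
    (h : lrs_hom X Y) : lrs_cmp f (lrs_cmp g h) = lrs_cmp (lrs_cmp f g) h.
Proof. exact: lrs_hom_eq. Qed.

Definition lrs_cat : category := Category lrs_cmp1m lrs_cmpm1 lrs_cmpA.

Definition open_immersion (X Y : lrs) (f : lrs_hom X Y) : Prop :=
  [/\ injective f,
      forall U : set X, open U -> open (f @` U)
    & forall x, bijective (comap f x)].

(* f is a homeomorphism onto a closed subset, and O_Y -> f_* O_X is surjective *)
Definition closed_immersion (X Y : lrs) (f : lrs_hom X Y) : Prop :=
  [/\ injective f,
      forall U : set X, closed U -> closed (f @` U)
    & forall x a, exists b, comap f x b = a].

Section Spec.
Variable A : comPzRingType.

Definition spec_open (U : set (prime_ideal A)) : Prop :=
  exists E : set A, U = [set p | ~ (E `<=` (p : set A))].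

Lemma spec_openT : spec_open setT.
Proof.
exists [set 1]; apply/seteqP; split => // p _ /(_ 1 erefl).
exact: prime_proper.
Qed.

Lemma spec_openI : setI_closed spec_open.
Proof.
move=> _ _ [E ->] [F ->]; exists [set e * f | e in E & f in F].
apply/seteqP; split => p /=.
  move=> [/existsNP[e /not_implyP[Ee pe]] /existsNP[f /not_implyP[Ff pf]]] h.
  by apply: (prime_mulN pe pf); apply: h; exists e => //; exists f.
move=> h; split => h'; apply: h => _ [e Ee [f Ff <-]].
  by rewrite mulrC; apply: (idealM (prime_is_ideal p)); exact: h'.
by apply: (idealM (prime_is_ideal p)); exact: h'.
Qed.

Lemma spec_open_bigU (I : Type) (f : I -> set (prime_ideal A)) :
  (forall i, spec_open (f i)) -> spec_open (\bigcup_i f i).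
Proof.
move=> /choice[E fE]; exists (\bigcup_i E i); apply/seteqP; split => p /=.
  by move=> [i _]; rewrite fE /= => h h'; apply: h => a Ea; apply: h'; exists i.
move=> /existsNP[a /not_implyP[[i _ Ea] pa]]; exists i => //.
by rewrite fE /= => /(_ a Ea).
Qed.

HB.instance Definition _ := isOpenTopological.Build (prime_ideal A)
  spec_openT spec_openI spec_open_bigU.

Definition spec_section (U : set (prime_ideal A))
    (s : forall p : prime_ideal A, localization p) : Prop :=
  forall p, U p -> exists (V : set (prime_ideal A)) (a f : A),
    [/\ open V, V p
      & forall q, U q -> V q -> exists qf : ~ q f, s q = frac a qf].

Lemma spec_section_sheaf U s : open U ->
  (forall p, U p -> exists V t, [/\ open V, V p, spec_section V t
                             & forall q, U q -> V q -> s q = t q]) ->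
  spec_section U s.
Proof.
move=> oU h p Up; have [V [t [oV Vp sV st]]] := h p Up.
have [W [a [f [oW Wp tW]]]] := sV p Vp.
exists (V `&` W), a, f; split; [exact: openI | by [] |].
by move=> q Uq [Vq Wq]; rewrite st //; exact: tW.
Qed.

Lemma spec_section1 U : open U -> spec_section U (fun=> 1).
Proof.
move=> oU p Up; exists setT, 1, 1; split => //; first exact: openT.
by move=> q _ _; exists (@prime_proper _ q).
Qed.

Lemma spec_sectionB U s t : open U -> spec_section U s -> spec_section U t ->
  spec_section U (fun p => s p - t p).
Proof.
move=> oU sU tU p Up; have [V [a [f [oV Vp sV]]]] := sU p Up.
have [W [b [g [oW Wp tW]]]] := tU p Up.
exists (V `&` W), (a * g + - b * f), (f * g); split; [exact: openI | by [] |].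
move=> q Uq [Vq Wq]; have [qf ->] := sV q Uq Vq; have [qg ->] := tW q Uq Wq.
exists (prime_mulN qf qg); rewrite -loc_addE -loc_oppE //.
Qed.

Lemma spec_sectionM U s t : open U -> spec_section U s -> spec_section U t ->
  spec_section U (fun p => s p * t p).
Proof.
move=> oU sU tU p Up; have [V [a [f [oV Vp sV]]]] := sU p Up.
have [W [b [g [oW Wp tW]]]] := tU p Up.
exists (V `&` W), (a * b), (f * g); split; [exact: openI | by [] |].
move=> q Uq [Vq Wq]; have [qf ->] := sV q Uq Vq; have [qg ->] := tW q Uq Wq.
by exists (prime_mulN qf qg); rewrite -loc_mulE.
Qed.

Lemma spec_basic_open (f : A) : open [set p : prime_ideal A | ~ p f].
Proof.
exists [set f]; apply/seteqP; split => p /= h; first by move/(_ f erefl).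
by move=> pf; apply: h => _ ->.
Qed.

Lemma spec_germ_surj (p : prime_ideal A) (x : localization p) :
  exists U s, [/\ open U, U p, spec_section U s & s p = x].
Proof.
have [a [f [pf ->]]] := fracP x.
pose s (q : prime_ideal A) : localization q :=
  if pselect (~ q f) is left qf then frac a qf else 0.
have sE (q : prime_ideal A) (qf : ~ q f) : s q = frac a qf.
  by rewrite /s; case: pselect => // qf'; exact: frac_eqW.
exists [set q : prime_ideal A | ~ q f], s.
split; [exact: spec_basic_open | exact: pf | | exact: sE].
move=> q qf; exists [set q : prime_ideal A | ~ q f], a, f.
split => //; first exact: spec_basic_open.
by move=> r rf _; exists rf.
Qed.

Lemma spec_germ_inj U s t (p : prime_ideal A) : open U -> U p ->
  spec_section U s -> spec_section U t -> s p = t p ->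
  exists V, [/\ open V, V p & forall q, V q -> s q = t q].
Proof.
move=> oU Up sU tU; have [V [a [f [oV Vp sV]]]] := sU p Up.
have [W [b [g [oW Wp tW]]]] := tU p Up.
have [pf ->] := sV p Up Vp; have [pg ->] := tW p Up Wp => /frac_eq[u pu e].
exists (U `&` (V `&` W) `&` [set q : prime_ideal A | ~ q u]); split => //.
  by apply: openI; [apply: openI => //; exact: openI | exact: spec_basic_open].
move=> q [[Uq [Vq Wq]] qu].
have [qf ->] := sV q Uq Vq; have [qg ->] := tW q Uq Wq.
by apply/frac_eq; exists u.
Qed.

Definition Spec : lrs := @LRS (prime_ideal A) (fun p => localization p)
  spec_section spec_section_sheaf spec_section1 spec_sectionB spec_sectionM
  spec_germ_surj spec_germ_inj (@localization_local A).

End Spec.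

(* On global sections g is phi, so g is the morphism of affine schemes Spec phi. *)
Definition induced_by (R A : comPzRingType) (phi : {rmorphism R -> A})
    (g : lrs_hom (Spec A) (Spec R)) : Prop :=
  forall (q : Spec A) (a : R), comap g q (to_loc (g q) a) = to_loc q (phi a).

Definition affine (X : lrs) : Prop :=
  exists A : comPzRingType, @isomorphic lrs_cat X (Spec A).

Definition scheme (X : lrs) : Prop :=
  forall x : X, exists (A : comPzRingType) (j : lrs_hom (Spec A) X),
    open_immersion j /\ range j x.

Definition noetherian_scheme (X : lrs) : Prop :=
  compact [set: X] /\
  forall x : X, exists (A : comPzRingType) (j : lrs_hom (Spec A) X),
    [/\ noetherian_ring A, open_immersion j & range j x].

(* f is P on suitable affine charts around x and f x; such charts are nonempty, *)
(* so they come from nonzero rings.                                             *)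
Definition locally_of (P : forall R A : comNzRingType, {rmorphism R -> A} -> Prop)
    (X Y : lrs) (f : lrs_hom X Y) : Prop :=
  forall x : X, exists (R A : comNzRingType) (phi : {rmorphism R -> A})
      (i : lrs_hom (Spec A) X) (j : lrs_hom (Spec R) Y)
      (g : lrs_hom (Spec A) (Spec R)),
    [/\ open_immersion i, open_immersion j & range i x] /\
    [/\ lrs_cmp f i = lrs_cmp j g, induced_by phi g & P R A phi].

Definition finite_type (X Y : lrs) (f : lrs_hom X Y) : Prop :=
  locally_of finite_type_ring f /\
  forall V : set Y, open V -> compact V -> compact (f @^-1` V).

(* T0 is the closed subscheme of T defined by a nilpotent ideal J: as J is     *)
(* nilpotent i is surjective, the kernel of comap i z is the stalk of J at     *)
(* i z, and J ^ n = 0 may be checked on stalks, on products of n elements.     *)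
Definition nilpotent_immersion (T0 T : lrs) (i : lrs_hom T0 T) : Prop :=
  [/\ closed_immersion i, forall y : T, range i y
    & exists n : nat, forall (z : T0) (s : 'I_n -> stalk T (i z)),
        (forall k, comap i z (s k) = 0) -> \prod_(k < n) s k = 0].

Definition formally_etale (X Y : lrs) (f : lrs_hom X Y) : Prop :=
  forall (T0 T : lrs) (i : lrs_hom T0 T),
    scheme T0 -> affine T -> nilpotent_immersion i ->
  forall (u : lrs_hom T0 X) (v : lrs_hom T Y), lrs_cmp f u = lrs_cmp v i ->
  exists! w : lrs_hom T X, lrs_cmp w i = u /\ lrs_cmp f w = v.

Definition etale (X Y : lrs) (f : lrs_hom X Y) : Prop :=
  locally_of finite_presentation_ring f /\ formally_etale f.

Definition noeth_sch (k : comPzRingType) : category :=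
  @full (@slice lrs_cat (Spec k)) (fun X => noetherian_scheme (dom X)).

Section EtaleSite.
Variables (k : comPzRingType) (S : noeth_sch k).

Definition site : category := @slice (noeth_sch k) S.

Definition sch (U : site) : lrs := dom (full_val (dom U)).

Definition sch_hom (U V : site) (f : hom U V) : lrs_hom (sch U) (sch V) :=
  over_fun (over_fun f).

Definition sch_str (U : site) : lrs_hom (sch U) (dom (full_val S)) :=
  over_fun (str U).

Definition etale_covering (U : site) (I : Type) (V : I -> site)
    (p : forall i, hom (V i) U) : Prop :=
  (forall i, etale (sch_hom (p i))) /\
  forall x : sch U, exists i, range (sch_hom (p i)) x.

(* Equality on V i x_U V j is tested on its T-valued points. *)
Definition is_sheaf (F : presheaf site) : Prop :=
  forall (U : site) (I : Type) (V : I -> site) (p : forall i, hom (V i) U),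
    etale_covering p ->
  forall s : forall i, F (V i),
    (forall i j (T : site) (f : hom T (V i)) (g : hom T (V j)),
       p i \oc f = p j \oc g -> res F f (s i) = res F g (s j)) ->
  exists! t : F U, forall i, res F (p i) t = s i.

Definition surjective_psh (F G : presheaf site) (a : psh_hom F G) : Prop :=
  forall (U : site) (t : G U), exists (I : Type) (V : I -> site)
      (p : forall i, hom (V i) U),
    etale_covering p /\
    forall i, exists s : F (V i), a (V i) s = res G (p i) t.

(* By the Yoneda lemma, a morphism from a scheme Y to F is an element of F Y.  *)
(* Morphisms on the intersections Z i x_Y Z j and Z i x_Y Y' are compared on   *)
(* T-valued points. An etale neighborhood of P is an etale e : Y' -> Y with P  *)
(* in its image.                                                               *)
Definition vertical (F G : presheaf site) (a : psh_hom F G) : Prop :=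
  forall n : nat, (0 < n)%N ->
  forall (Y : site) (Z : 'I_n -> site)
    (iota : forall i, hom (Z i) Y) (r : forall i, hom Y (Z i)),
    (forall i, closed_immersion (sch_hom (iota i))) ->
    (forall i, r i \oc iota i = idm (Z i)) ->
    (forall i j, (iota i \oc r i) \oc (iota j \oc r j) =
                 (iota j \oc r j) \oc (iota i \oc r i)) ->
    (forall i j : 'I_n, (j <= i)%N -> exists q : hom (Z j) (Z j),
       iota i \oc (r i \oc iota j) = iota j \oc q) ->
  forall (g : G Y) (lambda : forall i, F (Z i)),
    (forall i, a (Z i) (lambda i) = res G (iota i) g) ->
    (forall i j (T : site) (u : hom T (Z i)) (v : hom T (Z j)),
       iota i \oc u = iota j \oc v ->
       res F u (lambda i) = res F v (lambda j)) ->
  forall P : sch Y, (exists i, range (sch_hom (iota i)) P) ->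
  exists (Y' : site) (e : hom Y' Y) (lambda' : F Y'),
    [/\ etale (sch_hom e), range (sch_hom e) P, a Y' lambda' = res G e g
      & forall i (T : site) (u : hom T (Z i)) (v : hom T Y'),
          iota i \oc u = e \oc v -> res F u (lambda i) = res F v lambda'].

Definition affine_finite_type (X : site) : Prop :=
  affine (sch X) /\ finite_type (sch_str X).

Definition P4 (F : presheaf site) : Prop :=
  exists (X : site) (a : psh_hom (yoneda X) F),
    [/\ affine_finite_type X, surjective_psh a, vertical a
      & exists (R : site) (b : psh_hom (yoneda R) (fibre_product a a)),
          [/\ affine_finite_type R, surjective_psh b & vertical b]].

Definition structural (F : presheaf site) : psh_hom F (yoneda (slice_base S)) :=
  @PshHom site F (yoneda (slice_base S)) (fun U _ => to_slice_base U)
    (fun U V f _ => esym (to_slice_base_unique (to_slice_base V \oc f))).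

Definition P5 (F : presheaf site) : Prop := P4 F /\ vertical (structural F).

Record group_presheaf : Type := GroupPresheaf {
  grp : site -> groupType;
  grp_res : forall U V : site, hom U V -> {multiplicative grp V -> grp U};
  grp_res_id : forall U (s : grp U), grp_res (idm U) s = s;
  grp_res_cmp : forall U V W (g : hom V W) (f : hom U V) (s : grp W),
    grp_res (g \oc f) s = grp_res f (grp_res g s)
}.

Definition underlying (F : group_presheaf) : presheaf site :=
  @Presheaf site (fun U => grp F U) (fun U V f => grp_res F f)
    (@grp_res_id F) (@grp_res_cmp F).

Record group_sheaf : Type := GroupSheaf {
  group_psh :> group_presheaf;
  group_is_sheaf : is_sheaf (underlying group_psh)
}.

Definition presentable_group_sheaf (F : group_sheaf) : Prop :=
  P5 (underlying F).

End EtaleSite.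

(* Main.v *)
(* Zariski-locally on both sides, an open cover identifies with an open        *)
(* subfunctor, and a lifting along such an identification is forced: this      *)
(* makes Zariski covers surjective and vertical. G is a finite union of affine *)
(* noetherian opens U_a, so X is the disjoint union of the U_a, which is       *)
(* affine, and R that of finitely many affine opens covering the intersections *)
(* of U_a and U_b. The group law gives the verticality of G -> S: starting     *)
(* from l = 1, replace l successively by l (l r_i)^-1 (lambda_i r_i), which    *)
(* restricts to lambda_i on Y_i and is unchanged on Y_j for j < i, since r_i   *)
(* maps Y_j to its intersection with Y_i.                                      *)
Require Import Defs.
From HB Require Import structures.
From mathcomp Require Import -(notations) mpoly.
From mathcomp Require Import all_boot all_order all_algebra generic_quotient ring finmap.
From mathcomp Require Import boolp classical_sets cardinality topology.

Set Implicit Arguments.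
Unset Strict Implicit.
Unset Printing Implicit Defensive.

Import Defs GRing.Theory.

Local Open Scope quotient_scope.
Local Open Scope classical_set_scope.
Local Open Scope ring_scope.

(** * Morphisms of locally ringed spaces and open immersions *)

(** Let [G] represent [F]. For P4, a finite cover of the noetherian scheme [G] by affine opens gives
    [X], the spectrum of the product of their rings, with [pi : X -> G]. Intersections of these
    opens need not be affine, so [R] is the spectrum of the product of the rings of finitely many
    affine opens covering them; its two maps [p1], [p2] to [X] have equal composites with [pi]
    ([affine_presentation]). Being locally open immersions into [G], these maps inherit local finite
    type from [G] ([locally_finite_type_cmp]), and quasi-compactness is automatic over a noetherian
    ring ([spec_noetherian_compact]).

    The morphisms from [X] to [F] and from [R] to the fibre product of [X] with itself over [F] have
    the same local form: an open of the source is identified with an open subfunctor of the target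
    ([represented_chart], [relation_chart]). Surjectivity follows because such subfunctors cover the
    target and small opens are etale ([chart_surjective], [open_immersion_etale]). For verticality,
    all the given liftings send the points over [P] to one point of the source. A single chart
    around that point lifts the datum near [P], and uniqueness of lifts in the chart forces
    agreement with the given liftings ([chart_vertical]).

    P5 further asks that [F -> S] be vertical. This uses only the group law and the retractions:
    sections on the closed subschemes are extended one at a time to all of [Y] ([group_vertical]).

    The geometry below rests on two facts: a morphism landing in an open immersion factors uniquely
    through it ([open_immersion_factor], [open_immersion_mono]), and a ring localization at one
    element is an open immersion of spectra ([spec_hom_open_immersion]). *)

Lemma rmorph_invertible (A B : comPzRingType) (h : {rmorphism A -> B}) a :
  invertible a -> invertible (h a).
Proof. by move=> [b ab]; exists (h b); rewrite -rmorphM ab rmorph1. Qed.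

Section StalkCast.
Variable X : lrs.

(** Comorphisms of two morphisms that agree on points start from stalks at points that are equal but
    not convertible; this transport lets them be compared. *)
Definition stalk_cast (x y : X) (e : x = y) : {rmorphism stalk X x -> stalk X y} :=
  match e in _ = z return {rmorphism stalk X x -> stalk X z} with erefl => idfun end.

Lemma stalk_cast_id (x : X) (e : x = x) a : stalk_cast e a = a.
Proof. by rewrite (Prop_irrelevance e erefl). Qed.

Lemma stalk_cast_section (s : forall x, stalk X x) (x y : X) (e : x = y) :
  stalk_cast e (s x) = s y.
Proof. by case: _ / e. Qed.

Lemma stalk_cast_invertible (x y : X) (e : x = y) a :
  invertible (stalk_cast e a) -> invertible a.
Proof. by case: _ / e a. Qed.

End StalkCast.

Lemma comap_cast (X Y : lrs) (f : lrs_hom X Y) (x y : X) (e : x = y)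
    (e' : f x = f y) a :
  comap f y (stalk_cast e' a) = stalk_cast e (comap f x a).
Proof. by case: _ / e e' => e'; rewrite !stalk_cast_id. Qed.

Lemma lrs_hom_ext (X Y : lrs) (f g : lrs_hom X Y) (e : forall x, f x = g x) :
  (forall x a, comap f x a = comap g x (stalk_cast (e x) a)) -> f = g.
Proof.
case: f g e => [f c p1 p2 p3] [g d q1 q2 q3] /= e.
have fg : f = g by apply: funext.
case: _ / fg d q1 q2 q3 e => d q1 q2 q3 e cd.
by apply: lrs_hom_eq => x a; rewrite cd stalk_cast_id.
Qed.

Lemma lrs_hom_eqP (X Y : lrs) (f g : lrs_hom X Y) : f = g -> forall x,
  exists e : f x = g x, forall a, comap f x a = comap g x (stalk_cast e a).
Proof. by move=> -> x; exists erefl => a; rewrite stalk_cast_id. Qed.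

Lemma bij_rmorphism_inv (R S : comNzRingType) (h : {rmorphism R -> S}) :
  bijective h -> exists g : {rmorphism S -> R}, cancel h g /\ cancel g h.
Proof.
case=> g hg gh.
pose g' : {rmorphism S -> R} := HB.pack g
  (GRing.isZmodMorphism.Build _ _ g (can2_zmod_morphism hg gh))
  (GRing.isMonoidMorphism.Build _ _ g (can2_monoid_morphism hg gh)).
by exists g'.
Qed.

Lemma section_restrict (X : lrs) (U W : set X) s :
  open U -> open W -> U `<=` W -> section X W s -> section X U s.
Proof.
move=> oU oW UW sW; apply: section_sheaf => // x Ux.
by exists W, s; split => //; exact: UW.
Qed.

Lemma existT_inj (I : Type) (P : I -> Type) (i : I) (u v : P i) :
  existT P i u = existT P i v -> u = v.
Proof.
by move=> e; have := projT2_eq e; rewrite (Prop_irrelevance (projT1_eq e) erefl).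
Qed.

Section OpenImmersion.
Variables (V X : lrs) (j : lrs_hom V X).
Hypothesis oj : open_immersion j.

Lemma open_immersion_inj : injective j. Proof. by case: oj. Qed.

Lemma open_immersion_open U : open U -> open (j @` U).
Proof. by case: oj => _ + _; exact. Qed.

Lemma open_immersion_range : open (range j).
Proof. by apply: open_immersion_open; exact: openT. Qed.

Lemma open_immersion_section O s v : open O -> section V O s -> O v ->
  exists W s', [/\ open W, W (j v), section X W s'
    & forall v', W (j v') -> O v' /\ comap j v' (s' (j v')) = s v'].
Proof.
move=> oO sO Ov; have [_ _ /(_ v)[c _ cK]] := oj.
have [U [s' [oU Uv sU s'E]]] := germ_surj (c (s v)).
have oUO : open (j @^-1` U `&` O) by apply: openI => //; apply: lrs_continuous.
have sU' := section_restrict oUO (lrs_continuous j oU) (@subIsetl _ _ _)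
  (comap_section j oU sU).
have sO' := section_restrict oUO oO (@subIsetr _ _ _) sO.
have e : comap j v (s' (j v)) = s v by rewrite s'E cK.
have [V' [oV' V'v V'E]] := germ_inj oUO (conj Uv Ov) sU' sO' e.
exists (U `&` j @` (V' `&` O)), s'; split.
- by apply: openI => //; apply/open_immersion_open/openI.
- by split=> //; exists v.
- apply: (section_restrict _ oU (@subIsetl _ _ _)) => //.
  by apply: openI => //; apply/open_immersion_open/openI.
- move=> v' [Uv' [v'' [V'v' Ov']]] /open_immersion_inj vv.
  by rewrite vv in V'v' Ov'; split=> //; rewrite V'E.
Qed.

(** Injectivity of [j] forces the map on points and bijectivity on stalks forces the comorphisms.
    Continuity is the openness of [j], and [open_immersion_section] handles sections. *)
Lemma open_immersion_factor (T : lrs) (f : lrs_hom T X) :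
  (forall t, range j (f t)) -> exists w : lrs_hom T V, lrs_cmp j w = f.
Proof.
move=> fj.
have /choice[w jw] : forall t, exists v, j v = f t.
  by move=> t; have [v _ jv] := fj t; exists v.
have [_ _ bj] := oj.
have /all_sig[c cP] : forall v, {c : {rmorphism stalk V v -> stalk X (j v)} |
    cancel (comap j v) c /\ cancel c (comap j v)}.
  by move=> v; apply: cid; apply: bij_rmorphism_inv.
pose d (t : T) : {rmorphism stalk V (w t) -> stalk T t} :=
  comap f t \o stalk_cast (jw t) \o c (w t).
have preE (O : set V) : w @^-1` O = f @^-1` (j @` O).
  apply/seteqP; split => t /=; first by move=> Ot; exists (w t).
  by move=> [v Ov]; rewrite -jw => /open_immersion_inj <-.
have wc (O : set V) : open O -> open (w @^-1` O).
  by move=> oO; rewrite preE; apply: lrs_continuous; apply: open_immersion_open.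
have ws (O : set V) s : open O -> section V O s ->
    section T (w @^-1` O) (fun t => d t (s (w t))).
  move=> oO sO; apply: section_sheaf; first exact: wc.
  move=> t Ot.
  have [W [s' [oW Wt sW s'E]]] := open_immersion_section oO sO Ot.
  exists (f @^-1` W), (fun t => comap f t (s' (f t))); split.
  - exact: lrs_continuous.
  - by rewrite /= -jw.
  - exact: comap_section.
  move=> t' _ Wt' /=; have Wt'' : W (j (w t')) by rewrite jw.
  by rewrite -(s'E _ Wt'').2 (cP _).1 (stalk_cast_section s' (jw t')).
have wl t a : invertible (d t a) -> invertible a.
  move=> /comap_local/stalk_cast_invertible ia.
  by rewrite -[a](cP (w t)).2; exact: rmorph_invertible.
exists (LRSHom wc ws wl).
apply: (@lrs_hom_ext _ _ (lrs_cmp j (LRSHom wc ws wl)) f jw) => t a /=.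
by rewrite (cP _).1.
Qed.

Lemma open_immersion_mono (T : lrs) (g h : lrs_hom T V) :
  lrs_cmp j g = lrs_cmp j h -> g = h.
Proof.
move=> /lrs_hom_eqP gh.
have e t : g t = h t by have [e _] := gh t; exact: open_immersion_inj e.
apply: (lrs_hom_ext (e := e)) => t a.
have [_ _ bj] := oj; have [c _ cK] := bj (g t).
rewrite -[a]cK; have [e' /= ->] := gh t.
by rewrite -(@comap_cast _ _ j _ _ (e t) e').
Qed.

End OpenImmersion.

Lemma open_immersion_cmp (X Y Z : lrs) (g : lrs_hom Y Z) (f : lrs_hom X Y) :
  open_immersion g -> open_immersion f -> open_immersion (lrs_cmp g f).
Proof.
move=> [gi go gb] [fi fo fb]; split.
- exact: inj_comp.
- by move=> U oU; rewrite -(image_comp f g); apply/go/fo.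
- by move=> x; apply: bij_comp.
Qed.

Lemma open_immersion_id (X : lrs) : open_immersion (lrs_id X).
Proof.
split=> //; first by move=> U; rewrite image_id.
by move=> x; exists idfun.
Qed.

Lemma open_immersion_cancel (X Y Z : lrs) (g : lrs_hom Y Z) (f : lrs_hom X Y) :
  open_immersion g -> open_immersion (lrs_cmp g f) -> open_immersion f.
Proof.
move=> og; have [gi go gb] := og; move=> [fi fo fb]; split.
- by move=> x y e; apply: fi => /=; rewrite e.
- move=> U oU; have := lrs_continuous g (fo _ oU).
  congr (open _); apply/seteqP; split=> y /=.
    by move=> [x Ux] /gi <-; exists x.
  by move=> [x Ux <-]; exists x.
- move=> x; have [c cK Kc] := gb (f x); have [d dK Kd] := fb x.
  apply: (@Bijective _ _ _ (comap g (f x) \o d)) => a /=.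
    by rewrite -{1}[a]Kc (dK (c a)).
  exact: Kd.
Qed.

Lemma lrs_hom_cover_eq (I : Type) (V : I -> lrs) (X Y : lrs)
    (j : forall i, lrs_hom (V i) X) (f g : lrs_hom X Y) :
  (forall i, open_immersion (j i)) -> (forall x, exists i, range (j i) x) ->
  (forall i, lrs_cmp f (j i) = lrs_cmp g (j i)) -> f = g.
Proof.
move=> oj jX fg.
have e x : f x = g x.
  have [i [v _ <-]] := jX x.
  by have [e _] := lrs_hom_eqP (fg i) v.
apply: (lrs_hom_ext (e := e)) => x a.
have [i [v _ vx]] := jX x; case: _ / vx a => a.
have [_ _ /(_ v)/bij_inj] := oj i; apply.
have [e' /= ->] := lrs_hom_eqP (fg i) v.
by rewrite (Prop_irrelevance e' (e (j i v))).
Qed.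

Section Glue.
Variables (I : Type) (V : I -> lrs) (X Y : lrs).
Variables (j : forall i, lrs_hom (V i) X) (f : forall i, lrs_hom (V i) Y).
Hypothesis oj : forall i, open_immersion (j i).
Hypothesis jX : forall x, exists i, range (j i) x.
Hypothesis jdisj : forall i k v w, j i v = j k w -> i = k.

(** Each point of [X] lies in exactly one piece, so the morphism is read off there and no agreement
    on overlaps has to be checked. The condition on sections is local. *)
Lemma lrs_glue_disjoint : exists h : lrs_hom X Y, forall i, lrs_cmp h (j i) = f i.
Proof.
have /choice[w jw] : forall x, exists iv : {i & V i}, j _ (projT2 iv) = x.
  by move=> x; have [i [v _ <-]] := jX x; exists (existT _ i v).
have wj i v : w (j i v) = existT _ i v.
  case: (w _) (jw (j i v)) => k u /= e; have ki := jdisj e.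
  by case: _ / ki v e => v /(open_immersion_inj (oj _)) ->.
have /all_sig[c cP] : forall iv : {i & V i},
    {c : {rmorphism stalk (V (projT1 iv)) (projT2 iv) -> stalk X (j _ (projT2 iv))} |
    cancel (comap (j _) (projT2 iv)) c /\ cancel c (comap (j _) (projT2 iv))}.
  move=> iv; apply: cid; apply: bij_rmorphism_inv.
  by have [_ _] := oj (projT1 iv).
pose h x : Y := f _ (projT2 (w x)).
pose d x : {rmorphism stalk Y (h x) -> stalk X x} :=
  stalk_cast (jw x) \o c (w x) \o comap (f _) (projT2 (w x)).
have preE (O : set Y) : h @^-1` O = \bigcup_i (j i @` (f i @^-1` O)).
  apply/seteqP; split => x /=.
    by rewrite /h => Ox; exists (projT1 (w x)) => //; exists (projT2 (w x)).
  by move=> [i _ [v Ov <-]]; rewrite /h wj.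
have hc (O : set Y) : open O -> open (h @^-1` O).
  move=> oO; rewrite preE; apply: bigcup_open => i _.
  by apply: open_immersion_open => //; exact: lrs_continuous.
have dj i v (e : h (j i v) = f i v) a :
    comap (j i) v (d (j i v) a) = comap (f i) v (stalk_cast e a).
  (* The pair [w (j i v)] is only propositionally [(i, v)], so all that depends on it is generalized
     before the equality is eliminated. *)
  rewrite /d /=; move: (jw (j i v)) a e; rewrite /h.
  case: (w _) (wj i v) => k u /= E.
  case: E (E) => ik; case: _ / ik v => v E.
  rewrite (existT_inj E) => _ jkv a e; rewrite !stalk_cast_id.
  by rewrite (cP (existT _ k v)).2.
have hs (O : set Y) s : open O -> section Y O s ->
    section X (h @^-1` O) (fun x => d x (s (h x))).
  move=> oO sO; apply: section_sheaf; first exact: hc.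
  move=> x; have [i [v _ <-]] := jX x => /= Ohv.
  have hj k u : h (j k u) = f k u by rewrite /h wj.
  have Ov : O (f i v) by rewrite -hj.
  have [W [s' [oW Wt sW s'E]]] := open_immersion_section (oj i)
     (lrs_continuous (f i) oO) (comap_section (f i) oO sO) Ov.
  exists (W `&` range (j i)), s'; split.
  - by apply: openI => //; exact: open_immersion_range.
  - by split=> //; exists v.
  - apply: (section_restrict _ oW (@subIsetl _ _ _)) => //.
    by apply: openI => //; exact: open_immersion_range.
  move=> _ /= _ [/[swap] -[u _ <-] Wu].
  have [_ _ /(_ u)/bij_inj] := oj i; apply.
  by rewrite (dj _ _ (hj i u)) (s'E _ Wu).2 stalk_cast_section.
have hl x a : invertible (d x a) -> invertible a.
  move=> /stalk_cast_invertible ia; apply: (@comap_local _ _ (f (projT1 (w x)))).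
  by rewrite -[comap _ _ a](cP (w x)).2; exact: rmorph_invertible.
exists (LRSHom hc hs hl) => i.
have e v : h (j i v) = f i v by rewrite /h wj.
by apply: (@lrs_hom_ext _ _ (lrs_cmp (LRSHom hc hs hl) (j i)) (f i) e) => v a; exact: dj.
Qed.

End Glue.

(** * Morphisms of affine schemes and localizations *)

Lemma prime_ideal_ext (A : comPzRingType) (p q : prime_ideal A) :
  (forall a, p a <-> q a) -> p = q.
Proof.
case: p q => [p p1 p2 p3] [q q1 q2 q3] /= pq.
have e : p = q by apply/funext => a; apply/propext.
case: _ / e q1 q2 q3 {pq} => q1 q2 q3.
by congr PrimeIdeal; exact: Prop_irrelevance.
Qed.

Lemma prime_exp (A : comPzRingType) (p : prime_ideal A) a n : ~ p a -> ~ p (a ^+ n).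
Proof.
move=> pa; elim: n => [|n ih]; first by rewrite expr0; exact: prime_proper.
by rewrite exprS; exact: prime_mulN.
Qed.

Lemma prime_unit (A : comPzRingType) (p : prime_ideal A) a : invertible a -> ~ p a.
Proof.
move=> [b ab] pa; apply: (@prime_proper _ p).
by rewrite -ab mulrC; exact: idealM (prime_is_ideal p) _ _ pa.
Qed.

Section SpecMorphism.
Variables (A B : comPzRingType) (phi : {rmorphism A -> B}).

Section Preimage.
Variable q : prime_ideal B.

Lemma preimage_is_ideal : is_ideal [set a | q (phi a)].
Proof.
have [q0 qD qM] := prime_is_ideal q; split => /=.
- by rewrite rmorph0.
- by move=> a b qa qb; rewrite rmorphD; exact: qD.
- by move=> a b qb; rewrite rmorphM; exact: qM.
Qed.

Lemma preimage_proper : ~ q (phi 1).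
Proof. by rewrite rmorph1; exact: prime_proper. Qed.

Lemma preimage_prime a b : q (phi (a * b)) -> q (phi a) \/ q (phi b).
Proof. by rewrite rmorphM => /primeP. Qed.

Definition spec_fun : prime_ideal A :=
  PrimeIdeal preimage_is_ideal preimage_proper preimage_prime.

Definition spec_comap_fun (x : localization spec_fun) : localization q :=
  @frac B q (phi (pnum (repr x))) (phi (pden (repr x))) (@pdenP _ _ (repr x)).

Lemma spec_comapE a s (ps : ~ spec_fun s) :
  spec_comap_fun (frac a ps) = @frac B q (phi a) (phi s) ps.
Proof.
have [u pu] := repr_frac a ps; rewrite /spec_comap_fun => e.
by apply/frac_eq; exists (phi u) => //; rewrite -!rmorphM e.
Qed.

Lemma spec_comap_zmod : zmod_morphism spec_comap_fun.
Proof.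
move=> x y; have [a [s [ps ->]]] := fracP x; have [b [t [pt ->]]] := fracP y.
rewrite [- frac b pt]loc_oppE [frac a ps + _]loc_addE !spec_comapE.
rewrite [X in _ = _ + X]loc_oppE [RHS]loc_addE.
by apply: frac_eqW; rewrite !(rmorphD, rmorphM, rmorphN).
Qed.

Lemma spec_comap_monoid : monoid_morphism spec_comap_fun.
Proof.
split; first by rewrite [1]/(frac _ _) spec_comapE; apply: frac_eqW; rewrite rmorph1.
move=> x y; have [a [s [ps ->]]] := fracP x; have [b [t [pt ->]]] := fracP y.
rewrite [frac a ps * _]loc_mulE !spec_comapE [RHS]loc_mulE.
by apply: frac_eqW; rewrite !rmorphM.
Qed.

HB.instance Definition _ := GRing.isZmodMorphism.Build _ _ spec_comap_fun spec_comap_zmod.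
HB.instance Definition _ := GRing.isMonoidMorphism.Build _ _ spec_comap_fun spec_comap_monoid.

Definition spec_comap : {rmorphism localization spec_fun -> localization q} :=
  spec_comap_fun.

End Preimage.

Lemma spec_fun_open (V : set (Spec A)) : open V -> open (spec_fun @^-1` V : set (Spec B)).
Proof.
move=> [E ->]; exists (phi @` E); apply/seteqP; split=> q /= h h'; apply: h.
  by move=> a Ea; apply: h'; exists a.
by move=> _ [a Ea <-]; exact: h'.
Qed.

Lemma spec_comap_section (V : set (Spec A)) s : open V -> section (Spec A) V s ->
  section (Spec B) (spec_fun @^-1` V) (fun q => spec_comap q (s (spec_fun q))).
Proof.
move=> oV sV q Vq; have [W [a [f [oW Wq sW]]]] := sV _ Vq.
exists (spec_fun @^-1` W), (phi a), (phi f).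
split=> //; first exact: spec_fun_open.
move=> r Vr Wr; have [rf ->] := sW _ Vr Wr.
by exists rf; rewrite /= spec_comapE.
Qed.

Lemma spec_comap_local q a : invertible (spec_comap q a) -> invertible a.
Proof.
have [b [s [ps ->]]] := fracP a.
by rewrite /= spec_comapE => /frac_invertible h; apply/frac_invertible.
Qed.

Definition spec_hom : lrs_hom (Spec B) (Spec A) :=
  @LRSHom (Spec B) (Spec A) spec_fun spec_comap spec_fun_open spec_comap_section spec_comap_local.

Lemma spec_hom_induced : induced_by phi spec_hom.
Proof.
by move=> q a; rewrite /to_loc /= spec_comapE; apply: frac_eqW; rewrite rmorph1.
Qed.

(** [B] is [A_f], characterized through elements so as to cover both the fraction ring [away f] and
    the projection of a product onto a factor, which inverts an idempotent. *)
Definition is_localization_at (f : A) : Prop :=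
  [/\ invertible (phi f),
      forall b, exists n a, b * phi f ^+ n = phi a
    & forall a, phi a = 0 -> exists n, f ^+ n * a = 0].

Section LocalizationAt.
Variable f : A.
Hypothesis phif : is_localization_at f.

Lemma localization_at_primeN (q : prime_ideal B) : ~ q (phi f).
Proof. by case: phif => u _ _; exact: prime_unit. Qed.

Lemma localization_at_primeM (q : prime_ideal B) b n : q (b * phi f ^+ n) <-> q b.
Proof.
split; first by case/primeP => // /(prime_exp (@localization_at_primeN q)).
by rewrite mulrC; exact: idealM (prime_is_ideal q) _ _.
Qed.

Lemma localization_at_inj (I : set B) b n : is_ideal I -> I (b * phi f ^+ n) -> I b.
Proof.
case: phif => -[u fu] _ _ [_ _ IM] /(IM (u ^+ n)).
by rewrite mulrCA -exprMn [u * _]mulrC fu expr1n mulr1.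
Qed.

Lemma localization_at_eq a a' : phi a = phi a' -> exists n, f ^+ n * a = f ^+ n * a'.
Proof.
case: phif => _ _ h e; have [|n] := h (a - a').
  by rewrite rmorphB e subrr.
by rewrite mulrBr => /subr0_eq e'; exists n.
Qed.

(** The preimage of [p] is its extension [Q] to [B]; by [QP], membership in [Q] can be tested on any
    numerator. *)
Lemma localization_at_image (p : prime_ideal A) : ~ p f -> range spec_fun p.
Proof.
case: phif => fi surj _ pf.
pose Q := [set b | exists n a, b * phi f ^+ n = phi a /\ p a].
have pI := prime_is_ideal p.
have QP b n a : b * phi f ^+ n = phi a -> (Q b <-> p a).
  move=> e; split; last by exists n, a.
  move=> [m [a' [e' pa']]].
  have [|k] := @localization_at_eq (a * f ^+ m) (a' * f ^+ n).
    by rewrite !(rmorphM, rmorphXn) -e -e' mulrAC.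
  move=> e''; have : p (f ^+ k * (a * f ^+ m)).
    by rewrite e''; apply: idealM => //; rewrite mulrC; exact: idealM.
  move=> /primeP[/(prime_exp pf)//|] /primeP[//|/(prime_exp pf)//].
have QI : is_ideal Q.
  split.
  - by exists 0%N, 0; rewrite mul0r rmorph0; split=> //; exact: ideal0.
  - move=> b c [n [a [e pa]]] [m [a' [e' pa']]].
    exists (n + m)%N, (a * f ^+ m + a' * f ^+ n); split.
      by rewrite !(rmorphD, rmorphM, rmorphXn) -e -e' exprD; ring.
    by apply: idealD => //; rewrite mulrC; apply: idealM.
  - move=> b c [n [a [e pa]]]; have [m [a' e']] := surj b.
    exists (m + n)%N, (a' * a); split; last exact: idealM.
    by rewrite rmorphM -e -e' exprD; ring.
have Q1 : ~ Q 1.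
  have e : 1 * phi f ^+ 0 = phi 1 by rewrite expr0 mulr1 rmorph1.
  by rewrite (QP _ _ _ e); exact: prime_proper.
have Qp b c : Q (b * c) -> Q b \/ Q c.
  have [n [a e]] := surj b; have [m [a' e']] := surj c.
  have e'' : b * c * phi f ^+ (n + m) = phi (a * a').
    by rewrite rmorphM -e -e' exprD; ring.
  rewrite (QP _ _ _ e) (QP _ _ _ e') (QP _ _ _ e'') => /primeP; exact.
exists (PrimeIdeal QI Q1 Qp) => //; apply: prime_ideal_ext => a /=.
by apply: (QP _ 0%N); rewrite expr0 mulr1.
Qed.

Lemma spec_hom_range : range spec_hom = [set p | ~ p f].
Proof.
apply/seteqP; split => p /=; last exact: localization_at_image.
by move=> [q _ <-]; exact: localization_at_primeN.
Qed.

(** Up to powers of the unit [phi f], elements of [B] are images of elements of [A]. Clearing these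
    powers gives injectivity on primes, the equations of the image of an open set, and the
    bijections on stalks. *)
Lemma spec_hom_open_immersion : open_immersion spec_hom.
Proof.
have [fi surj _] := phif; split.
- move=> q r e; apply: prime_ideal_ext => b; have [n [a ea]] := surj b.
  have : spec_fun q a <-> spec_fun r a by rewrite [spec_fun q]e.
  by rewrite /= -ea !localization_at_primeM.
- move=> U [E ->].
  (* The factor [f] excludes the primes containing [f], which are outside the image. *)
  exists [set a * f | a in [set a | exists b n, E b /\ b * phi f ^+ n = phi a]].
  apply/seteqP; split => p /=.
    move=> [q h <-] h'; apply: h => b Eb; have [n [a ea]] := surj b.
    apply/(localization_at_primeM q b n); rewrite ea.
    have : q (phi (a * f)) by apply: h'; exists a => //; exists b, n.
    by rewrite rmorphM -[phi f]expr1 => /localization_at_primeM.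
  move=> h; have [|q _ qp] := @localization_at_image p.
    move=> pf; apply: h => _ [a _ <-].
    by apply: idealM => //; exact: prime_is_ideal.
  exists q => // h'; apply: h => _ [a [b [n [Eb e]]] <-].
  rewrite mulrC; apply: idealM; first exact: prime_is_ideal.
  by rewrite -qp /= -e; apply/localization_at_primeM; exact: h'.
- move=> q; suff [inj sur] : injective (spec_comap q) /\
      (forall x, exists y, spec_comap q y = x).
    have [g gK] := choice sur; exists g; last exact: gK.
    by move=> x; apply: inj; rewrite gK.
  split.
    move=> x y; have [a [s [ps ->]]] := fracP x; have [b [t [pt ->]]] := fracP y.
    rewrite /= !spec_comapE => /frac_eq[u qu]; have [n [u' e]] := surj u.
    move=> e'; have [|m e''] := @localization_at_eq (u' * (a * t)) (u' * (b * s)).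
      rewrite !rmorphM -e; rewrite mulrAC e'; ring.
    apply/frac_eq; exists (f ^+ m * u'); last by rewrite -!mulrA.
    apply: prime_mulN; first by apply: prime_exp; exact: localization_at_primeN.
    by rewrite /= -e; move/localization_at_primeM.
  move=> x; have [b [t [qt ->]]] := fracP x.
  have [n [a ea]] := surj b; have [m [s es]] := surj t.
  have ps : ~ spec_fun q (s * f ^+ n).
    rewrite /= rmorphM rmorphXn -es.
    by move/localization_at_primeM/localization_at_primeM.
  exists (frac (a * f ^+ m) ps); rewrite /= spec_comapE; apply: frac_eqW.
  by rewrite !(rmorphM, rmorphXn) -ea -es; ring.
Qed.

End LocalizationAt.

End SpecMorphism.

(** * The ring A_f, noetherian rings and finite products *)

Section Away.
Variables (A : comPzRingType) (f : A).

Definition is_power (s : A) : Prop := exists n, s = f ^+ n.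

Lemma is_power1 : is_power 1. Proof. by exists 0%N. Qed.

Lemma is_powerM s t : is_power s -> is_power t -> is_power (s * t).
Proof. by move=> [n ->] [m ->]; exists (n + m)%N; rewrite exprD. Qed.

Record prefrac_away : Type := PrefracAway {
  anum : A;
  aden : A;
  adenP : is_power aden
}.

HB.instance Definition _ := gen_eqMixin prefrac_away.
HB.instance Definition _ := gen_choiceMixin prefrac_away.

Definition away_rel (x y : prefrac_away) : bool :=
  `[< exists2 u, is_power u & u * (anum x * aden y) = u * (anum y * aden x) >].

Lemma away_rel_refl : reflexive away_rel.
Proof. by move=> x; apply/asboolP; exists 1 => //; exact: is_power1. Qed.

Lemma away_rel_sym : symmetric away_rel.
Proof. by move=> x y; apply/asboolP/asboolP => -[u pu e]; exists u. Qed.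

Lemma away_rel_trans : transitive away_rel.
Proof.
move=> y x z /asboolP[u pu e] /asboolP[v pv g]; apply/asboolP.
exists (u * v * aden y); first by do 2?apply: is_powerM => //; exact: adenP.
transitivity (v * aden z * (u * (anum x * aden y))); first by ring.
rewrite e; transitivity (u * aden x * (v * (anum y * aden z))); first by ring.
by rewrite g; ring.
Qed.

Canonical away_equiv := EquivRel away_rel away_rel_refl away_rel_sym away_rel_trans.

(** The ring [A_f], in which 1 = 0 is allowed, as happens when [f] is nilpotent. *)
Definition away := {eq_quot away_equiv}.
HB.instance Definition _ := Choice.on away.
HB.instance Definition _ := EqQuotient.on away.

Definition afrac (a s : A) (ps : is_power s) : away := \pi_away (PrefracAway a ps).

Lemma afracP (x : away) : exists a s (ps : is_power s), x = afrac a ps.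
Proof. by elim/quotW: x => -[a s ps]; exists a, s, ps. Qed.

Lemma afrac_eq a s (ps : is_power s) b t (pt : is_power t) :
  afrac a ps = afrac b pt <-> exists2 u, is_power u & u * (a * t) = u * (b * s).
Proof.
split; first by move=> /eqmodP /asboolP.
by move=> h; apply/eqmodP/asboolP.
Qed.

Definition away_zero := afrac 0 is_power1.
Definition away_one := afrac 1 is_power1.
Definition away_opp (x : away) : away := afrac (- anum (repr x)) (adenP (repr x)).
Definition away_add (x y : away) : away :=
  afrac (anum (repr x) * aden (repr y) + anum (repr y) * aden (repr x))
       (is_powerM (adenP (repr x)) (adenP (repr y))).
Definition away_mul (x y : away) : away :=
  afrac (anum (repr x) * anum (repr y))
       (is_powerM (adenP (repr x)) (adenP (repr y))).

Lemma repr_afrac a s (ps : is_power s) : exists2 u, is_power u &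
  u * (anum (repr (afrac a ps)) * s) = u * (a * aden (repr (afrac a ps))).
Proof.
set r := repr _; apply/(afrac_eq _ (adenP r)).
by rewrite -[RHS]reprK -/r; case: (r).
Qed.

Lemma away_oppE a s (ps : is_power s) : away_opp (afrac a ps) = afrac (- a) ps.
Proof.
apply/afrac_eq; have [u pu e] := repr_afrac a ps; exists u => //.
by rewrite !mulNr !mulrN e.
Qed.

Lemma away_addE a s (ps : is_power s) b t (pt : is_power t) :
  away_add (afrac a ps) (afrac b pt) = afrac (a * t + b * s) (is_powerM ps pt).
Proof.
apply/afrac_eq; have [u pu] := repr_afrac a ps; have [v pv] := repr_afrac b pt.
case: (repr (afrac a ps)) => a' s' ps'; case: (repr (afrac b pt)) => b' t' pt' /=.
move=> g e; exists (u * v); first exact: is_powerM.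
transitivity (v * t * t' * (u * (a' * s)) + u * s * s' * (v * (b' * t))).
  by ring.
by rewrite e g; ring.
Qed.

Lemma away_mulE a s (ps : is_power s) b t (pt : is_power t) :
  away_mul (afrac a ps) (afrac b pt) = afrac (a * b) (is_powerM ps pt).
Proof.
apply/afrac_eq; have [u pu] := repr_afrac a ps; have [v pv] := repr_afrac b pt.
case: (repr (afrac a ps)) => a' s' ps'; case: (repr (afrac b pt)) => b' t' pt' /=.
move=> g e; exists (u * v); first exact: is_powerM.
transitivity ((u * (a' * s)) * (v * (b' * t))); first by ring.
by rewrite e g; ring.
Qed.

Lemma afrac_eqW a s (ps : is_power s) b t (pt : is_power t) :
  a * t = b * s -> afrac a ps = afrac b pt.
Proof. by move=> e; apply/afrac_eq; exists 1; [exact: is_power1 | rewrite e]. Qed.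

Lemma away_addA : associative away_add.
Proof.
move=> x y z; have [a [s [ps ->]]] := afracP x; have [b [t [pt ->]]] := afracP y.
have [c [r [pr ->]]] := afracP z; rewrite !away_addE; apply: afrac_eqW; ring.
Qed.

Lemma away_addC : commutative away_add.
Proof.
move=> x y; have [a [s [ps ->]]] := afracP x; have [b [t [pt ->]]] := afracP y.
by rewrite !away_addE; apply: afrac_eqW; ring.
Qed.

Lemma away_add0 : left_id away_zero away_add.
Proof.
move=> x; have [a [s [ps ->]]] := afracP x.
by rewrite away_addE; apply: afrac_eqW; ring.
Qed.

Lemma away_addN : left_inverse away_zero away_opp away_add.
Proof.
move=> x; have [a [s [ps ->]]] := afracP x.
by rewrite away_oppE away_addE; apply: afrac_eqW; ring.
Qed.

Lemma away_mulA : associative away_mul.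
Proof.
move=> x y z; have [a [s [ps ->]]] := afracP x; have [b [t [pt ->]]] := afracP y.
have [c [r [pr ->]]] := afracP z; rewrite !away_mulE; apply: afrac_eqW; ring.
Qed.

Lemma away_mulC : commutative away_mul.
Proof.
move=> x y; have [a [s [ps ->]]] := afracP x; have [b [t [pt ->]]] := afracP y.
by rewrite !away_mulE; apply: afrac_eqW; ring.
Qed.

Lemma away_mul1 : left_id away_one away_mul.
Proof.
move=> x; have [a [s [ps ->]]] := afracP x.
by rewrite away_mulE; apply: afrac_eqW; ring.
Qed.

Lemma away_mulD : left_distributive away_mul away_add.
Proof.
move=> x y z; have [a [s [ps ->]]] := afracP x; have [b [t [pt ->]]] := afracP y.
have [c [r [pr ->]]] := afracP z; rewrite !(away_mulE, away_addE).
by apply: afrac_eqW; ring.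
Qed.

HB.instance Definition _ := GRing.isZmodule.Build away
  away_addA away_addC away_add0 away_addN.
HB.instance Definition _ := GRing.Zmodule_isComPzRing.Build away
  away_mulA away_mulC away_mul1 away_mulD.

Definition to_away (a : A) : away := afrac a is_power1.

Lemma to_away_zmod : zmod_morphism to_away.
Proof.
move=> a b; rewrite [- to_away b]away_oppE [RHS]away_addE.
by apply: afrac_eqW; ring.
Qed.

Lemma to_away_monoid : monoid_morphism to_away.
Proof. by split=> // a b; rewrite [RHS]away_mulE; apply: afrac_eqW; ring. Qed.

HB.instance Definition _ := GRing.isZmodMorphism.Build _ _ to_away to_away_zmod.
HB.instance Definition _ := GRing.isMonoidMorphism.Build _ _ to_away to_away_monoid.

Lemma to_away_localization : is_localization_at to_away f.
Proof.
split.
- have pf : is_power f by exists 1%N.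
  by exists (afrac 1 pf); rewrite [LHS]away_mulE; apply: afrac_eqW; ring.
- move=> b; have [a [s [ps ->]]] := afracP b; have [n sn] := ps.
  exists n, a; rewrite -rmorphXn /= [LHS]away_mulE; apply: afrac_eqW.
  by rewrite -sn; ring.
- move=> a /afrac_eq[u [n ->]]; rewrite !mulr1 mulr0 => e; by exists n.
Qed.

End Away.

Section FiniteGeneration.
Variable A : comPzRingType.

(** Generation phrased by the ideals containing the generators, which avoids explicit coefficients
    when ideals are moved along ring morphisms. *)
Lemma fin_genP (I : set A) : is_ideal I ->
  fin_gen I <-> exists s : seq A, (forall x, x \in s -> I x) /\
    forall J : set A, is_ideal J -> (forall x, x \in s -> J x) -> I `<=` J.
Proof.
move=> II; pose span (s : seq A) := [set a | exists c : nat -> A,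
                                 a = \sum_(i < size s) c i * s`_i].
have sumI J (s : seq A) (c : nat -> A) : is_ideal J -> (forall x, x \in s -> J x) ->
    J (\sum_(i < size s) c i * s`_i).
  move=> JI sJ; elim/big_ind: _ => [||i _]; [exact: ideal0|exact: idealD|].
  by apply: idealM => //; apply: sJ; exact: mem_nth.
have spanI s : is_ideal (span s).
  split.
  - by exists (fun=> 0); rewrite big1// => i _; rewrite mul0r.
  - move=> _ _ [c ->] [d ->]; exists (fun i => c i + d i).
    by rewrite -big_split; apply: eq_bigr => i _; rewrite mulrDl.
  - move=> a _ [c ->]; exists (fun i => a * c i).
    by rewrite mulr_sumr; apply: eq_bigr => i _; rewrite mulrA.
have span_in s x : x \in s -> span s x.
  move=> xs; exists (fun i => if i == index x s then 1 else 0).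
  have lt : (index x s < size s)%N by rewrite index_mem.
  rewrite (bigD1 (Ordinal lt))//= eqxx mul1r nth_index// big1 ?addr0// => i.
  by rewrite -val_eqE /= => /negPf ->; rewrite mul0r.
split=> [[s ->]|[s [sI sJ]]]; exists s.
  split; first exact: span_in.
  by move=> J JI sJ _ [c ->]; exact: (sumI _ s c).
apply/seteqP; split; first by apply: sJ; [exact: spanI|exact: span_in].
by move=> _ [c ->]; exact: (sumI _ s c).
Qed.

(* The elements that lie in the ideal generated by a finite part of E form an ideal. *)
Lemma noetherian_finite_subset (E : set A) : noetherian_ring A ->
  exists s : seq A, (forall x, x \in s -> E x) /\
    forall J : set A, is_ideal J -> (forall x, x \in s -> J x) -> E `<=` J.
Proof.
move=> nA; pose I := [set a | exists s : seq A, (forall x, x \in s -> E x) /\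
    forall J : set A, is_ideal J -> (forall x, x \in s -> J x) -> J a].
have II : is_ideal I.
  split.
  - by exists [::]; split=> // J /ideal0.
  - move=> a b [s [sE sJ]] [t [tE tJ]]; exists (s ++ t); split.
      by move=> x; rewrite mem_cat => /orP[/sE|/tE].
    move=> J JI stJ; apply: idealD => //; [apply: sJ|apply: tJ] => // x xs;
      by apply: stJ; rewrite mem_cat xs ?orbT.
  - move=> a b [s [sE sJ]]; exists s; split=> // J JI /(sJ _ JI).
    exact: idealM.
have /(fin_genP II)[s [sI sJ]] := nA I II.
have EI : E `<=` I.
  move=> a Ea; exists [:: a]; split=> [x|J _]; first by rewrite inE => /eqP ->.
  by apply; rewrite inE.
suff [t [tE tJ]] : exists t : seq A, (forall x, x \in t -> E x) /\
    forall J : set A, is_ideal J -> (forall x, x \in t -> J x) ->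
      forall x, x \in s -> J x.
  exists t; split=> // J JI /(tJ _ JI) h a /EI; exact: sJ.
elim: s sI {sJ} => [|a s ih] sI; first by exists [::].
have [x xs|t [tE tJ]] := ih; first by apply: sI; rewrite inE xs orbT.
have [|u [uE uJ]] := sI a; first by rewrite inE eqxx.
exists (u ++ t); split; first by move=> x; rewrite mem_cat => /orP[/uE|/tE].
move=> J JI utJ x; rewrite inE => /orP[/eqP ->|].
  by apply: uJ => // y yu; apply: utJ; rewrite mem_cat yu.
by apply: tJ => // y yu; apply: utJ; rewrite mem_cat yu orbT.
Qed.

End FiniteGeneration.

Lemma preimage_ideal (A B : comPzRingType) (phi : {rmorphism A -> B}) (I : set B) :
  is_ideal I -> is_ideal (phi @^-1` I).
Proof.
move=> [I0 ID IM]; split=> [|a b|a b] /=.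
- by rewrite rmorph0.
- by rewrite rmorphD; exact: ID.
- by rewrite rmorphM; exact: IM.
Qed.

(** An ideal of [B] is generated by the image of its contraction to [A], since each of its elements
    is a numerator up to a unit. *)
Lemma localization_at_noetherian (A B : comPzRingType) (phi : {rmorphism A -> B}) f :
  is_localization_at phi f -> noetherian_ring A -> noetherian_ring B.
Proof.
move=> phif nA I II; apply/fin_genP => //.
have pI := preimage_ideal phi II; have /(fin_genP pI)[s [sI sJ]] := nA _ pI.
exists (map phi s); split=> [_ /mapP[a /sI + ->]//|J JI sJ' b Ib].
have [_ surj _] := phif; have [n [a e]] := surj b.
apply: (localization_at_inj phif JI (n := n)); rewrite e.
apply: (sJ _ (preimage_ideal phi JI)) => [x xs|].
  by apply: sJ'; exact: map_f.
by rewrite /= -e mulrC; exact: idealM II _ _ Ib.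
Qed.

Definition dprod (I : Type) (A : I -> Type) : Type := forall i, A i.

Section ProductRing.
Variables (I : Type) (A : I -> comPzRingType).
Local Notation P := (dprod A).

HB.instance Definition _ := gen_eqMixin P.
HB.instance Definition _ := gen_choiceMixin P.

Lemma dprod_ext (x y : P) : (forall i, x i = y i) -> x = y.
Proof. exact: functional_extensionality_dep. Qed.

Definition dprod_zero : P := fun=> 0.
Definition dprod_one : P := fun=> 1.
Definition dprod_opp (x : P) : P := fun i => - x i.
Definition dprod_add (x y : P) : P := fun i => x i + y i.
Definition dprod_mul (x y : P) : P := fun i => x i * y i.

Lemma dprod_addA : associative dprod_add.
Proof. by move=> x y z; apply: dprod_ext => i; exact: addrA. Qed.
Lemma dprod_addC : commutative dprod_add.
Proof. by move=> x y; apply: dprod_ext => i; exact: addrC. Qed.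
Lemma dprod_add0 : left_id dprod_zero dprod_add.
Proof. by move=> x; apply: dprod_ext => i; exact: add0r. Qed.
Lemma dprod_addN : left_inverse dprod_zero dprod_opp dprod_add.
Proof. by move=> x; apply: dprod_ext => i; exact: addNr. Qed.
Lemma dprod_mulA : associative dprod_mul.
Proof. by move=> x y z; apply: dprod_ext => i; exact: mulrA. Qed.
Lemma dprod_mulC : commutative dprod_mul.
Proof. by move=> x y; apply: dprod_ext => i; exact: mulrC. Qed.
Lemma dprod_mul1 : left_id dprod_one dprod_mul.
Proof. by move=> x; apply: dprod_ext => i; exact: mul1r. Qed.
Lemma dprod_mulD : left_distributive dprod_mul dprod_add.
Proof. by move=> x y z; apply: dprod_ext => i; exact: mulrDl. Qed.

HB.instance Definition _ := GRing.isZmodule.Build P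
  dprod_addA dprod_addC dprod_add0 dprod_addN.
HB.instance Definition _ := GRing.Zmodule_isComPzRing.Build P
  dprod_mulA dprod_mulC dprod_mul1 dprod_mulD.

Definition dproj (i : I) (x : P) : A i := x i.

Lemma dproj_zmod i : zmod_morphism (dproj i). Proof. by []. Qed.
Lemma dproj_monoid i : monoid_morphism (dproj i). Proof. by []. Qed.

HB.instance Definition _ i := GRing.isZmodMorphism.Build _ _ (dproj i) (dproj_zmod i).
HB.instance Definition _ i := GRing.isMonoidMorphism.Build _ _ (dproj i) (dproj_monoid i).

End ProductRing.

Section FiniteProduct.
Variables (I : finType) (A : I -> comPzRingType).
Local Notation P := (dprod A).

Definition dinj (i : I) (a : A i) : P := @dfwith I A (fun=> 0) i a.
Definition dunit (i : I) : P := dinj (1 : A i).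

Lemma dinj_id i (a : A i) : dinj a i = a. Proof. exact: dfwith_in. Qed.

Lemma dinj_out i k (a : A i) : i != k -> dinj a k = 0.
Proof. by move=> ik; exact: dfwith_out. Qed.

Lemma dunitM i (x : P) : dunit i * x = dinj (x i).
Proof.
apply: dprod_ext => k; transitivity (dinj (1 : A i) k * x k); first by [].
by have [ik|ik] := eqVneq i k; [case: _ / ik; rewrite !dinj_id mul1r|rewrite !dinj_out// mul0r].
Qed.

Lemma dprod_sumE (r : seq I) (F : I -> P) k : (\sum_(i <- r) F i) k = \sum_(i <- r) F i k.
Proof. by elim: r => [|i r ih]; rewrite ?big_nil// !big_cons -ih. Qed.

Lemma dprod_sum (x : P) : x = \sum_i dinj (x i).
Proof.
apply: dprod_ext => k; rewrite dprod_sumE (bigD1 k)//= dinj_id.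
by rewrite big1 ?addr0// => i ik; rewrite dinj_out.
Qed.

(** Multiplying by the idempotent [dunit i] kills all coordinates but [i]. Hence the spectrum of
    each factor is open in that of the product. *)
Lemma dproj_localization i : is_localization_at (@dproj I A i) (dunit i).
Proof.
split.
- by exists 1; rewrite mulr1; exact: dinj_id.
- by move=> b; exists 0%N, (dinj b); rewrite mulr1 [RHS]dinj_id.
- move=> x xi; exists 1%N; rewrite dunitM; apply: dprod_ext => k.
  have [ik|ik] := eqVneq i k; last by rewrite dinj_out.
  by case: _ / ik; rewrite dinj_id; exact: xi.
Qed.

Lemma dunit_cover (p : prime_ideal P) : exists i, ~ p (dunit i).
Proof.
apply: contrapT => h; apply: (@prime_proper _ p).
have [p0 pD _] := prime_is_ideal p.
rewrite (dprod_sum 1); elim/big_ind: _ => //.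
by move=> i _; apply: contrapT => pi; apply: h; exists i.
Qed.

Lemma dunit_disjoint (p : prime_ideal P) i k : ~ p (dunit i) -> ~ p (dunit k) -> i = k.
Proof.
move=> pi pk; apply/eqP; apply: contrapT => /negP ik; apply: (prime_mulN pi pk).
have -> : dunit i * dunit k = 0.
  rewrite dunitM; apply: dprod_ext => l.
  have [il|il] := eqVneq i l; last by rewrite dinj_out.
  by case: _ / il; rewrite dinj_id /dunit dinj_out// eq_sym.
exact: ideal0 (prime_is_ideal p).
Qed.

(** The idempotents split an ideal of a finite product into ideals of the factors, whose generators
    are collected. *)
Lemma dprod_noetherian : (forall i, noetherian_ring (A i)) -> noetherian_ring P.
Proof.
move=> nA J JI; apply/fin_genP => //.
have dinjI K i : is_ideal K -> is_ideal [set a : A i | K (dinj a)].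
  move=> [K0 KD KM]; split=> [|a b|a b] /=.
  - congr K: K0; apply: dprod_ext => k.
    have [ik|ik] := eqVneq i k; last by rewrite dinj_out.
    by case: _ / ik; rewrite dinj_id.
  - move=> Ka Kb; congr K: (KD _ _ Ka Kb); apply: dprod_ext => k.
    transitivity (dinj a k + dinj b k); first by [].
    have [ik|ik] := eqVneq i k; last by rewrite !dinj_out// addr0.
    by case: _ / ik; rewrite !dinj_id.
  - move=> /(KM (dinj a)); congr K; apply: dprod_ext => k.
    transitivity (dinj a k * dinj b k); first by [].
    have [ik|ik] := eqVneq i k; last by rewrite !dinj_out// mulr0.
    by case: _ / ik; rewrite !dinj_id.
have gens i := (fin_genP (dinjI J i JI)).1 (nA i _ (dinjI J i JI)).
have /all_sig[s sP] := fun i => cid (gens i).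
exists (flatten [seq map (@dinj i) (s i) | i <- enum I]).
split=> [x /flatten_mapP[i _ /mapP[a /(sP i).1 Ja ->]]//|K KI sK x Jx].
have [K0 KD _] := KI; rewrite (dprod_sum x); elim/big_ind: _ => // i _.
apply: ((sP i).2 _ (dinjI K i KI)) => [a sa|] /=.
  by apply: sK; apply/flatten_mapP; exists i; rewrite ?mem_enum//; exact: map_f.
by rewrite -dunitM; exact: idealM JI _ _ Jx.
Qed.

End FiniteProduct.

(** * Noetherian affine schemes and etale open immersions *)

Section CompactCover.
Variable T : topologicalType.

(** A nonempty space can be given a base point; on an empty space the empty subcover works and no
    proper filter exists. *)
Lemma compact_cover_unpointed : @compact T = @cover_compact T.
Proof.
have [[x]|T0] := pselect (inhabited T).
  pose T' : ptopologicalType := HB.pack (Topological.sort T) (isPointed.Build T x).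
  exact: (@compact_cover T').
apply/funext => K; apply/propext; split=> _.
  move=> I D f _ _; exists fset0 => // x; by case: T0.
move=> F FF _; have [x _] := @filter_ex _ F FF _ filterT.
by case: T0.
Qed.

End CompactCover.

(** Let the sets [E i] define the opens of the cover. Finitely many elements of their union generate
    an ideal containing all of them, so a prime that misses some [E i] misses one of these elements;
    [g] recalls an index from which each element comes. *)
Lemma spec_noetherian_compact (A : comPzRingType) (U : set (Spec A)) :
  noetherian_ring A -> compact U.
Proof.
move=> nA; rewrite compact_cover_unpointed => I D f fo Uf.
have /choice[E EP] : forall i, exists E : set A, D i -> f i = [set p | ~ (E `<=` (p : set A))].
  move=> i; have [/fo[E ->]|nD] := pselect (D i); first by exists E.
  by exists set0.
have [s [sE sJ]] := noetherian_finite_subset (\bigcup_(i in D) E i) nA.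
have /choice[g gP] : forall a, exists i : option I, a \in s ->
    exists2 k, i = Some k & D k /\ E k a.
  move=> a; have [/sE[k Dk Eka]|] := boolP (a \in s); last by exists None.
  by exists (Some k) => _; exists k.
exists [fset k in pmap g s]%fset.
  move=> k; rewrite !inE/= mem_pmap => /mapP[a /gP[k' -> [Dk _]] [->]].
  exact: Dk.
move=> p Up; have [i Di fip] := Uf p Up.
have : ~ (\bigcup_(i in D) E i `<=` p).
  by move=> h; move: fip; rewrite EP//= => -[] a Ea; apply: h; exists i.
move=> h; have [a as_ pa] : exists2 a, a \in s & ~ p a.
  apply: contrapT => h'; apply: h; apply: sJ; first exact: prime_is_ideal.
  by move=> a as_; apply: contrapT => pa; apply: h'; exists a.
have [k gk [Dk Eka]] := gP a as_; exists k.
  by rewrite /= !inE mem_pmap -gk; exact: map_f.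
by rewrite EP//= => /(_ a Eka).
Qed.

Lemma spec_basic_nbhs (A : comPzRingType) (U : set (Spec A)) (p : Spec A) :
  open U -> U p -> exists2 f : A, ~ p f & [set q : Spec A | ~ q f] `<=` U.
Proof.
move=> [E ->] /= /existsNP[f /not_implyP[Ef pf]]; exists f => // q /= qf h.
by apply: qf; exact: h.
Qed.

Lemma noetherian_small_open (X : lrs) (U : set X) (x : X) :
  noetherian_scheme X -> open U -> U x ->
  exists (A : comPzRingType) (j : lrs_hom (Spec A) X),
    [/\ noetherian_ring A, open_immersion j, range j x & range j `<=` U].
Proof.
move=> [_ /(_ x)[A [j [nA oj [a _ jx]]]]] oU Ux.
have [||f af fU] := @spec_basic_nbhs A (j @^-1` U) a.
- exact: lrs_continuous.
- by rewrite /= jx.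
have lf := to_away_localization f.
have rf := spec_hom_range lf.
exists (away f), (lrs_cmp j (spec_hom (to_away f))); split.
- exact: localization_at_noetherian lf nA.
- by apply: open_immersion_cmp => //; exact: spec_hom_open_immersion lf.
- have : range (spec_hom (to_away f)) a by rewrite rf.
  by move=> [q _ qa]; exists q => //=; rewrite -jx -qa.
- move=> _ [q _ <-]; apply: fU => /=.
  exact: localization_at_primeN lf _.
Qed.

Lemma spec_noetherian_scheme (A : comPzRingType) :
  noetherian_ring A -> noetherian_scheme (Spec A).
Proof.
move=> nA; split; first exact: spec_noetherian_compact.
move=> p; exists A, (lrs_id (Spec A)); split=> //.
exact: open_immersion_id.
Qed.

(** A nilpotent immersion is surjective on points, so [v] already lands in the image of [f] and
    factors through it; [f] is a monomorphism, which gives the rest. *)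
Lemma open_immersion_formally_etale (X Y : lrs) (f : lrs_hom X Y) :
  open_immersion f -> formally_etale f.
Proof.
move=> of_ T0 T i _ _ [_ si _] u v e.
have [t|w fw] := open_immersion_factor of_ (f := v).
  have [z _ <-] := si t; have [e' _] := lrs_hom_eqP e z.
  by exists (u z).
exists w; split.
  split=> //; apply: (open_immersion_mono of_).
  by rewrite e -fw; exact: (cmpA (c := lrs_cat)).
by move=> w' [_ fw']; apply: (open_immersion_mono of_); rewrite fw fw'.
Qed.

Lemma spec_nonzero (A : comPzRingType) (p : prime_ideal A) : (1 : A) != 0.
Proof.
apply/eqP => e; apply: (@prime_proper _ p).
by rewrite e; exact: ideal0 (prime_is_ideal p).
Qed.

(** The charts of [locally_of] come from nonzero rings; a point of the spectrum shows that the ring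
    at hand is one. *)
Lemma spec_nzring (A : comPzRingType) (p : prime_ideal A) :
  exists A' : comNzRingType, A = A' :> comPzRingType.
Proof.
have A1 := spec_nonzero p; case: A {p} A1 => A cA A1.
pose A0 := GRing.ComPzRing.Pack cA.
pose A' : comNzRingType := HB.pack A cA (GRing.PzSemiRing_isNonZero.Build A0 A1).
by exists A'.
Qed.

Lemma finite_presentation_id (A : comNzRingType) :
  @finite_presentation_ring A A idfun.
Proof.
exists 0%N, (mmap idfun (fun i : 'I_0 => 0)); split.
- by move=> c; rewrite /= mmapC.
- by move=> a; exists (mpolyC 0 a); rewrite /= mmapC.
- exists [::]; apply/seteqP; split=> q /=; last first.
    by move=> [c ->]; rewrite big_ord0 raddf0.
  rewrite [in mmap _ _ q](nvar0_mpolyC q) mmapC /= => q0.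
  by exists (fun=> 0); rewrite big_ord0 (nvar0_mpolyC q) q0 raddf0.
Qed.

Lemma induced_by_id (A : comPzRingType) : induced_by idfun (lrs_id (Spec A)).
Proof. by []. Qed.

(** A chart of [X] followed by [f] is a chart of [Y], and between these two charts [f] is the
    identity. *)
Lemma open_immersion_etale (X Y : lrs) (f : lrs_hom X Y) :
  noetherian_scheme X -> open_immersion f -> etale f.
Proof.
move=> [_ nX] of_; split; last exact: open_immersion_formally_etale.
move=> x; have [A [j [_ oj [p _ jx]]]] := nX x.
have [A' AA'] := spec_nzring p; subst A.
exists A', A', idfun, j, (lrs_cmp f j), (lrs_id _); split.
  by split=> //; [exact: open_immersion_cmp|exists p].
split; [by apply: lrs_hom_eq|exact: induced_by_id|exact: finite_presentation_id].
Qed.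

(** * Morphisms of finite type *)

(** [B] is generated by the images of the generators of [A] together with the inverse [u] of
    [psi f], to which the additional variable [ord0] is sent. *)
Lemma finite_type_localization (R A B : comNzRingType) (phi : {rmorphism R -> A})
    (psi : {rmorphism A -> B}) (f : A) :
  is_localization_at psi f -> finite_type_ring phi -> finite_type_ring (psi \o phi).
Proof.
move=> [[u fu] surj _] [n [h [hC hs]]].
pose v (i : 'I_n.+1) := if unlift ord0 i is Some j then psi (h (mpolyX R (mnm1 j))) else u.
pose h' : {rmorphism mpoly n.+1 R -> B} := mmap (psi \o phi) v.
exists n.+1, h'; split; first by move=> c; rewrite /h' /= mmapC.
have hX i : h' (mpolyX R (mnm1 i)) = v i by rewrite /h' /= mmapX mmap1U.
have psih q : exists q', h' q' = psi (h q).
  elim/mpolyind: q => [|c m p _ _ [q qp]]; first by exists 0; rewrite !rmorph0.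
  exists (mpolyC n.+1 c * \prod_(i < n) mpolyX R (mnm1 (lift ord0 i)) ^+ m i + q).
  rewrite -mul_mpolyC [mpolyX R m]mpolyXE_id !rmorphD !rmorphM qp hC /=; congr (_ * _ + _).
    by rewrite mmapC.
  rewrite !rmorph_prod; apply: eq_bigr => i _.
  by rewrite !rmorphXn hX /v liftK.
move=> b; have [k [a e]] := surj b; have [q qa] := hs a; have [q' q'a] := psih q.
exists (q' * mpolyX R (mnm1 ord0) ^+ k).
rewrite rmorphM rmorphXn hX q'a qa -e /v unlift_none -mulrA -exprMn fu.
by rewrite expr1n mulr1.
Qed.

Lemma induced_by_cmp (A B C : comPzRingType) (phi : {rmorphism A -> B})
    (psi : {rmorphism B -> C}) (g : lrs_hom (Spec B) (Spec A))
    (h : lrs_hom (Spec C) (Spec B)) :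
  induced_by phi g -> induced_by psi h -> induced_by (psi \o phi) (lrs_cmp g h).
Proof. by move=> gphi hpsi q a; rewrite /= gphi hpsi. Qed.

Definition local_open_immersion (X Y : lrs) (h : lrs_hom X Y) : Prop :=
  forall x, exists (V : lrs) (m : lrs_hom V X),
    [/\ open_immersion m, open_immersion (lrs_cmp h m) & range m x].

Lemma locally_finite_type_cmp (X Y Z : lrs) (h : lrs_hom X Y) (f : lrs_hom Y Z) :
  local_open_immersion h -> locally_of finite_type_ring f ->
  locally_of finite_type_ring (lrs_cmp f h).
Proof.
move=> hloc fft x; have [V [m [om ohm [v _ mv]]]] := hloc x.
have [R [A [phi [i [j [g [[oi oj [a _ ia]] [e gphi ft]]]]]]]] := fft (h x).
have [||s as_ sV] := @spec_basic_nbhs A (i @^-1` range (lrs_cmp h m)) a.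
- by apply: lrs_continuous; exact: open_immersion_range.
- by rewrite /= ia; exists v; rewrite //= mv.
(* The ring [away s] is hidden behind a variable [B], for which a nonzero ring can then be
   substituted. *)
have [B [psi [b [ls ba]]]] : exists (B : comPzRingType) (psi : {rmorphism A -> B})
    (b : Spec B), is_localization_at psi s /\ spec_hom psi b = a.
  have ls := to_away_localization s; have [b _ ba] := localization_at_image ls as_.
  by exists (away s), (to_away s), b.
have [B' BB'] := spec_nzring b; subst B.
have opsi := spec_hom_open_immersion ls.
(* The shrunken chart of [Y] lies in the image of [V], so it factors through [V] and yields a chart
   of [X]. *)
have [t|w hw] := open_immersion_factor ohm (f := lrs_cmp i (spec_hom psi)).
  by apply: sV => /=; exact: localization_at_primeN ls _.
exists R, B', (psi \o phi), (lrs_cmp m w), j, (lrs_cmp g (spec_hom psi)).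
split.
  split=> //.
    apply: open_immersion_cmp => //; apply: open_immersion_cancel ohm _.
    by rewrite hw; exact: open_immersion_cmp.
  exists b => //=; rewrite -mv; congr (m _).
  apply: (open_immersion_inj ohm).
  have [e' _] := lrs_hom_eqP hw b; transitivity (i (spec_hom psi b)) => //.
  by rewrite ba ia -mv.
split.
- have := lrs_cmpA f (lrs_cmp h m) w; rewrite hw => e'.
  transitivity (lrs_cmp (lrs_cmp f (lrs_cmp h m)) w); first exact: lrs_hom_eq.
  by rewrite -e' lrs_cmpA e lrs_cmpA.
- by apply: induced_by_cmp gphi _; exact: spec_hom_induced.
- exact: finite_type_localization ls ft.
Qed.

(** * The site and the verticality of group sheaves *)

Section Site.
Variables (k : comPzRingType) (S : noeth_sch k).

Lemma site_noetherian (U : site S) : noetherian_scheme (sch U).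
Proof. exact: full_valP (dom U). Qed.

Lemma site_hom_ext (U V : site S) (f g : hom U V) : sch_hom f = sch_hom g -> f = g.
Proof. by move=> e; apply/over_homP/over_homP. Qed.

(** Compatibility with the structure morphisms to [Spec k] and to [S] is inherited from [U], so only
    a morphism of locally ringed spaces has to be constructed. *)
Lemma site_lift (T U X : site S) (e : hom X U) (t : hom T U)
    (c : lrs_hom (sch T) (sch X)) :
  lrs_cmp (sch_hom e) c = sch_hom t -> exists c' : hom T X, sch_hom c' = c.
Proof.
move=> ec.
have kc : @cmp lrs_cat _ _ _ (str (full_val (dom X))) c = str (full_val (dom T)).
  rewrite -(over_comm (over_fun e)) -(over_comm (over_fun t)) /=.
  by rewrite -lrs_cmpA; congr lrs_cmp.
pose c1 : @hom (noeth_sch k) (dom T) (dom X) := OverHom kc.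
have Sc : str X \oc c1 = str T.
  rewrite -(over_comm e) -(over_comm t) -cmpA; congr (_ \oc _).
  exact: over_homP.
by exists (OverHom Sc).
Qed.

Section PullObject.
Variables (T : lrs) (U : site S) (h : lrs_hom T (sch U)).
Hypothesis nT : noetherian_scheme T.

Definition pull_obj_k : noeth_sch k :=
  @FullObj (@slice lrs_cat (Spec k)) (fun X => noetherian_scheme (dom X))
    (@Over lrs_cat (Spec k) T (lrs_cmp (str (full_val (dom U))) h)) nT.

Definition pull_hom_k : @hom (noeth_sch k) pull_obj_k (dom U) :=
  @OverHom lrs_cat (Spec k) (full_val pull_obj_k) (full_val (dom U)) h erefl.

Definition pull_obj : site S := @Over (noeth_sch k) S pull_obj_k (str U \oc pull_hom_k).

Definition pull_hom : hom pull_obj U :=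
  @OverHom (noeth_sch k) S pull_obj U pull_hom_k erefl.

End PullObject.

Lemma site_small_open (U : site S) (W : set (sch U)) (u : sch U) :
  open W -> W u -> exists (V : site S) (e : hom V U),
    [/\ etale (sch_hom e), range (sch_hom e) u & range (sch_hom e) `<=` W].
Proof.
move=> oW Wu; have [A [j [nA oj ju jW]]] := noetherian_small_open (site_noetherian U) oW Wu.
have nS := spec_noetherian_scheme nA.
exists (pull_obj j nS), (pull_hom j nS); split=> //.
exact: open_immersion_etale.
Qed.

Lemma etale_id (U : site S) : etale (sch_hom (idm U)).
Proof.
apply: open_immersion_etale; first exact: site_noetherian.
exact: open_immersion_id.
Qed.

(** A map to the base carries no information, so only an extension of the [lambda i] to [Y] is
    sought. It exists on all of [Y], and the etale neighborhood is the identity. *)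
Lemma group_vertical (F : group_sheaf S) : vertical (structural (underlying F)).
Proof.
move=> n n0 Y Z iota r _ ri _ rij g lambda _ glue P _.
pose rs (U V : site S) (f : hom U V) : grp F V -> grp F U := grp_res F f.
have rsM U V f a b : rs U V f (a * b)%g = (rs U V f a * rs U V f b)%g by exact: gmulfM.
have rs1 U V f : rs U V f 1%g = 1%g by apply: (mulgI (rs U V f 1%g)); rewrite -rsM !mulg1.
have rsV U V f a : rs U V f (a^-1)%g = ((rs U V f a)^-1)%g.
  by apply: (mulIg (rs U V f a)); rewrite -rsM !mulVg rs1.
have rsC U V W f g' a : rs U W (g' \oc f) a = rs U V f (rs V W g' a).
  exact: grp_res_cmp.
have ext m : (m <= n)%N -> exists l : grp F Y,
    forall i : 'I_n, (i < m)%N -> rs _ _ (iota i) l = lambda i.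
  elim: m => [|m ih] mn; first by exists 1%g.
  have [l lP] := ih (ltnW mn); pose i0 := Ordinal mn.
  pose l' : grp F Y :=
    (l * (rs _ _ (iota i0 \oc r i0) l)^-1 * rs _ _ (r i0) (lambda i0))%g.
  exists l' => i; rewrite ltnS => im.
  have -> : rs _ _ (iota i) l' = (rs _ _ (iota i) l *
      (rs _ _ (iota i0 \oc (r i0 \oc iota i)) l)^-1 *
      rs _ _ (r i0 \oc iota i) (lambda i0))%g.
    by rewrite rsM rsM rsV -!rsC cmpA.
  (* For [i < m], both correcting factors restrict on [Z i] to the pullback of [lambda i] along [q],
     one of them inverted, and cancel. For [i = i0], the retraction makes the first two factors
     cancel and leaves [lambda i0]. *)
  have [im'|mi] := ltnP i m.
    have [q iq] := rij i0 i (ltnW im').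
    have -> : rs _ _ (r i0 \oc iota i) (lambda i0) = rs _ _ q (lambda i).
      exact: glue.
    by rewrite iq rsC lP// mulgVK.
  have e : i = i0 by apply/val_inj/eqP; rewrite /= eqn_leq im mi.
  by rewrite e ri cmpm1 mulgV mul1g /rs grp_res_id.
have [l lP] := ext n (leqnn n).
exists Y, (idm Y), l; split.
- exact: etale_id.
- by exists P.
- by rewrite [LHS]to_slice_base_unique [RHS]to_slice_base_unique.
- move=> i T u v; rewrite cmp1m => <-.
  by rewrite res_cmp -(lP i (ltn_ord i)).
Qed.
End Site.

(** * Zariski covers of presheaves *)

Lemma finite_affine_cover (Y : lrs) (W : set Y) :
  noetherian_scheme Y -> open W -> compact W ->
  exists (I : finType) (A : I -> comPzRingType) (j : forall i, lrs_hom (Spec (A i)) Y),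
    [/\ forall i, noetherian_ring (A i), forall i, open_immersion (j i),
        forall y, W y -> exists i, range (j i) y & forall i, range (j i) `<=` W].
Proof.
move=> nY oW cW.
have /choice[c cP] : forall y, exists Aj : {A : comPzRingType & lrs_hom (Spec A) Y},
    [/\ noetherian_ring (projT1 Aj), open_immersion (projT2 Aj), range (projT2 Aj) y
      & W y -> range (projT2 Aj) `<=` W].
  move=> y; have [Wy|nWy] := pselect (W y).
    have [A [j [? ? ? ?]]] := noetherian_small_open nY oW Wy.
    by exists (existT _ A j).
  (* The family is indexed by all points of [Y]; those outside [W] get an arbitrary chart, and the
     finite subcover is indexed by points of [W]. *)
  have [A [j [? ? ? _]]] := noetherian_small_open nY openT (I : setT y).
  by exists (existT _ A j).
move: cW; rewrite compact_cover_unpointed => /(_ Y W (fun y => range (projT2 (c y)))) [].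
- by move=> y _; have [_ oj _ _] := cP y; exact: open_immersion_range.
- by move=> y Wy; exists y => //; have [] := cP y.
move=> D DW Wc.
exists D, (fun i => projT1 (c (val i))), (fun i => projT2 (c (val i))); split.
- by move=> i; have [] := cP (val i).
- by move=> i; have [] := cP (val i).
- by move=> y /Wc[d Dd ry]; exists [` Dd]%fset.
- move=> i; have [_ _ _ h] := cP (val i); apply: h.
  by apply: set_mem; apply: DW; exact: valP.
Qed.

Section SpecProduct.
Variables (I : finType) (A : I -> comPzRingType).

Definition dprod_incl (i : I) : lrs_hom (Spec (A i)) (Spec (dprod A)) :=
  spec_hom (@dproj I A i).

Lemma dprod_incl_open_immersion i : open_immersion (dprod_incl i).
Proof. exact: spec_hom_open_immersion (dproj_localization A i). Qed.

Lemma dprod_incl_cover x : exists i, range (dprod_incl i) x.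
Proof.
have [i xi] := dunit_cover x; exists i.
by rewrite (spec_hom_range (dproj_localization A i)).
Qed.

Lemma spec_dprod_glue (Y : lrs) (f : forall i, lrs_hom (Spec (A i)) Y) :
  exists h : lrs_hom (Spec (dprod A)) Y, forall i, lrs_cmp h (dprod_incl i) = f i.
Proof.
apply: lrs_glue_disjoint; [exact: dprod_incl_open_immersion|exact: dprod_incl_cover|].
move=> i l v w e; apply: (@dunit_disjoint _ _ (dprod_incl i v)).
  exact: localization_at_primeN (dproj_localization A i) _.
by rewrite e; exact: localization_at_primeN (dproj_localization A l) _.
Qed.

Lemma glue_local_open_immersion (Y : lrs) (h : lrs_hom (Spec (dprod A)) Y) :
  (forall i, open_immersion (lrs_cmp h (dprod_incl i))) -> local_open_immersion h.
Proof.
move=> oh x; have [i ix] := dprod_incl_cover x.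
by exists (Spec (A i)), (dprod_incl i); split=> //; exact: dprod_incl_open_immersion.
Qed.

End SpecProduct.

(** * Morphisms to a presheaf that are locally identifications with open subfunctors *)

Section Charts.
Variables (k : comPzRingType) (S : noeth_sch k) (X : site S).
Variables (H : presheaf (site S)) (b : psh_hom (yoneda X) H).

(* b identifies V with the open subfunctor of H whose preimage in a scheme U,  *)
(* under t : U -> H, is D U t.                                                 *)
Record chart (V : set (sch X)) (D : forall U : site S, H U -> set (sch U)) : Prop :=
  Chart {
    chart_open : forall U t, open (D U t);
    chart_openV : open V;
    chart_lift : forall U t (T : site S) (w : hom T U),
      (forall p, D U t (sch_hom w p)) ->
      exists s : hom T X, (forall p, V (sch_hom s p)) /\ b T s = res H w t;
    chart_inj : forall (T : site S) (s s' : hom T X),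
      (forall p, V (sch_hom s p)) -> (forall p, V (sch_hom s' p)) ->
      b T s = b T s' -> s = s';
    chart_mem : forall U t (T : site S) (e : hom T U) (s : hom T X) p,
      b T s = res H e t -> V (sch_hom s p) -> D U t (sch_hom e p)
  }.

(** A small open around [u] inside [D U t] is etale over [U] and [t] lifts on it; these opens,
    indexed by the points of [U], form the covering. *)
Lemma chart_surjective :
  (forall U (t : H U) (u : sch U), exists V D, chart V D /\ D U t u) ->
  surjective_psh b.
Proof.
move=> ch U t.
have /all_sig[V Vp] : forall u : sch U, {V : site S | exists p : hom V U,
    [/\ etale (sch_hom p), range (sch_hom p) u & exists s : hom V X, b V s = res H p t]}.
  move=> u; apply: cid; have [V [D [c Du]]] := ch U t u.
  have [V' [e [ee eu eD]]] := site_small_open (chart_open c t) Du.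
  exists V', e; split=> //.
  by have [p|s [_ bs]] := chart_lift c (t := t) (w := e); [apply: eD; exists p|exists s].
have /all_sig[p pP] := fun u => cid (Vp u).
exists (sch U), V, p; split; last by move=> u; have [] := pP u.
split; first by move=> u; have [] := pP u.
by move=> u; exists u; have [] := pP u.
Qed.

(* As r_i iota_j = q and iota_i r_i iota_j = iota_j q, the compatibility of    *)
(* the liftings on the intersections gives lambda_i = lambda_j at the points   *)
(* of Z_i and Z_j over a point of Y.                                           *)
Lemma chart_vertical :
  (forall x : sch X, exists V D, chart V D /\ V x) -> vertical b.
Proof.
move=> ch n n0 Y Z iota r ci ri _ rij g lambda lg glue P [i1 [z1 _ z1P]].
have inj i z z' : sch_hom (iota i) z = sch_hom (iota i) z' -> z = z'.
  by case: (ci i) => + _ _; exact.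
have [V [D [c Vz]]] := ch (sch_hom (lambda i1) z1).
have same (i j : 'I_n) z z' : (j <= i)%N -> sch_hom (iota i) z = P ->
    sch_hom (iota j) z' = P -> sch_hom (lambda i) z = sch_hom (lambda j) z'.
  move=> ji zP z'P; have [q e] := rij i j ji.
  have e' := glue i j _ _ _ e.
  have rz : sch_hom (r i) P = z.
    by rewrite -zP; have := congr1 (fun h => sch_hom h z) (ri i).
  (* Both have image [P] in [Y], because [iota j] sends [q z'] to [iota i (r i P)]. *)
  have qz : sch_hom q z' = z'.
    apply: (inj j); rewrite z'P -[RHS]zP -[in RHS]rz -z'P.
    by have := congr1 (fun h => sch_hom h z') e.
  have := congr1 (fun h => sch_hom h z') e'.
  by rewrite /= /sch_hom /= -/(sch_hom _) => h; rewrite -rz -[in RHS]qz -z'P.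
have VP i z : sch_hom (iota i) z = P -> V (sch_hom (lambda i) z).
  move=> zP; suff -> : sch_hom (lambda i) z = sch_hom (lambda i1) z1 by [].
  by have [h|/ltnW h] := leqP i i1; [apply/esym|]; exact: same.
(* Removed are the images of the points of each [Z i] that [lambda i] sends outside [V]: finitely
   many sets, closed because the [iota i] are closed immersions. Over [W] all [lambda i] take values
   in [V], where lifts are unique. *)
pose W := D Y g `&` ~` (\bigcup_i (sch_hom (iota i) @` ~` (sch_hom (lambda i) @^-1` V))).
have oW : open W.
  apply: openI; first exact: (chart_open c g).
  apply: closed_openC; apply: closed_bigcup => [|i _]; first exact: finite_finset.
  have [_ icl _] := ci i; apply: icl; apply: open_closedC.
  by apply: lrs_continuous; exact: chart_openV c.
have WP : W P.
  split.
    rewrite -z1P; apply: (chart_mem c (s := lambda i1)) => //.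
  by move=> [i _ [z nV zP]]; apply: nV; exact: VP.
have [Y' [e [ee eP eW]]] := site_small_open oW WP.
have [p|s [sV bs]] := chart_lift c (t := g) (w := e).
  by have [] := eW (sch_hom e p); [exists p|].
exists Y', e, s; split=> // i T u v uv; apply: (chart_inj c).
- move=> p; apply: contrapT => nV.
  have [_] := eW (sch_hom e (sch_hom v p)) (ex_intro2 _ _ _ I erefl).
  apply; exists i => //; exists (sch_hom u p) => //.
  by have := congr1 (fun h => sch_hom h p) uv.
- by move=> p; exact: sV.
rewrite !psh_nat lg bs -!res_cmp uv//.
Qed.

End Charts.

(** * Charts of a represented sheaf and of the equivalence relation on its cover *)

Section RepresentedChart.
Variables (k : comPzRingType) (S : noeth_sch k) (G X : site S) (F : presheaf (site S)).
Variables (alpha : psh_hom (yoneda G) F) (beta : psh_hom F (yoneda G)).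
Hypotheses (alphaK : forall U (s : yoneda G U), beta U (alpha U s) = s)
           (betaK : forall U (s : F U), alpha U (beta U s) = s).
Variable pi : hom X G.

Lemma represented_hom_nat (U V : site S) (f : hom U V) (s : yoneda X V) :
  alpha U (pi \oc res (yoneda X) f s) = res F f (alpha V (pi \oc s)).
Proof. by rewrite -psh_nat; congr (alpha U _); exact: cmpA. Qed.

Definition represented_hom : psh_hom (yoneda X) F := PshHom represented_hom_nat.

Lemma represented_homE (U : site S) (s : hom U X) t :
  represented_hom U s = t <-> pi \oc s = beta U t.
Proof.
split=> [<-|e]; first by rewrite [RHS]alphaK.
by rewrite -[RHS]betaK -e.
Qed.

Lemma represented_hom_inj (U : site S) (s s' : hom U X) :
  represented_hom U s = represented_hom U s' -> pi \oc s = pi \oc s'.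
Proof.
by move=> e; rewrite -(alphaK (pi \oc s)) -(alphaK (pi \oc s')); exact: congr1.
Qed.

(** A morphism to [G] with values in the image of [M] factors uniquely through [M], since [pi]
    restricted to [M] is an open immersion. *)
Lemma represented_chart (M : lrs) (m : lrs_hom M (sch X)) :
  open_immersion m -> open_immersion (lrs_cmp (sch_hom pi) m) ->
  chart represented_hom (range m)
    (fun U t => sch_hom (beta U t) @^-1` range (lrs_cmp (sch_hom pi) m)).
Proof.
move=> om opm; split.
- move=> U t; apply: lrs_continuous; exact: open_immersion_range.
- exact: open_immersion_range.
- move=> U t T w wD.
  have [|n hn] := open_immersion_factor opm (f := sch_hom (beta U t \oc w)) => //.
  have [|s sE] := @site_lift _ _ _ _ _ pi (beta U t \oc w) (lrs_cmp m n).
    by rewrite lrs_cmpA.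
  exists s; split; first by move=> p; rewrite sE; exists (n p).
  apply/represented_homE; rewrite psh_nat; apply: site_hom_ext.
  by transitivity (lrs_cmp (sch_hom pi) (sch_hom s)); rewrite // sE lrs_cmpA.
- move=> T s s' sm s'm /represented_hom_inj e.
  have [n nE] := open_immersion_factor om sm.
  have [n' n'E] := open_immersion_factor om s'm.
  apply: site_hom_ext; rewrite -nE -n'E; congr lrs_cmp.
  apply: (open_immersion_mono opm); rewrite -!lrs_cmpA nE n'E.
  by have := congr1 (fun h => sch_hom h) e.
- move=> U t T e s p /represented_homE; rewrite psh_nat => pis [v _ vE].
  have := congr1 (fun h => sch_hom h p) pis => /= <-.
  by exists v => //=; rewrite vE.
Qed.

Section Relation.
Variables (R : site S) (p1 p2 : hom R X).
Hypothesis pip : pi \oc p1 = pi \oc p2.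

Local Notation H := (fibre_product represented_hom represented_hom).

Lemma relation_hom_subproof (U : site S) (s : yoneda R U) :
  represented_hom U (p1 \oc s) = represented_hom U (p2 \oc s).
Proof.
apply: (congr1 (alpha U)); transitivity ((pi \oc p1) \oc s); first exact: cmpA.
by rewrite pip; exact: (esym (cmpA _ _ _)).
Qed.

Definition relation_hom_app (U : site S) (s : yoneda R U) : H U :=
  Fibre (relation_hom_subproof s).

Lemma relation_hom_nat (U V : site S) (f : hom U V) (s : yoneda R V) :
  relation_hom_app (res (yoneda R) f s) = res H f (relation_hom_app s).
Proof. by apply: fibre_eq; exact: cmpA. Qed.

Definition relation_hom : psh_hom (yoneda R) H := PshHom relation_hom_nat.

Lemma fibre_pi (U : site S) (t : H U) : pi \oc fib1 t = pi \oc fib2 t.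
Proof. exact: represented_hom_inj (fibP t). Qed.

(** A point of the fibre product with coordinates in the two images of [M] gives morphisms [n] and
    [n'] to [M]. They agree in [G], where [M] embeds, so they are equal and the point comes from
    [R]. *)
Lemma relation_chart (M : lrs) (m : lrs_hom M (sch R)) :
  open_immersion m -> open_immersion (lrs_cmp (sch_hom p1) m) ->
  open_immersion (lrs_cmp (sch_hom p2) m) ->
  open_immersion (lrs_cmp (sch_hom (pi \oc p1)) m) ->
  chart relation_hom (range m)
    (fun U t => sch_hom (fib1 t) @^-1` range (lrs_cmp (sch_hom p1) m) `&`
                sch_hom (fib2 t) @^-1` range (lrs_cmp (sch_hom p2) m)).
Proof.
move=> om o1 o2 opm; split.
- move=> U t; apply: openI; apply: lrs_continuous; exact: open_immersion_range.
- exact: open_immersion_range.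
- move=> U t T w wD.
  have [p|n hn] := open_immersion_factor o1 (f := sch_hom (fib1 t \oc w)).
    by have [] := wD p.
  have [p|n' hn'] := open_immersion_factor o2 (f := sch_hom (fib2 t \oc w)).
    by have [] := wD p.
  have nn' : n = n'.
    apply: (open_immersion_mono opm).
    transitivity (lrs_cmp (sch_hom pi) (lrs_cmp (lrs_cmp (sch_hom p1) m) n)).
      exact: lrs_hom_eq.
    rewrite hn [RHS](_ : _ = lrs_cmp (sch_hom pi) (lrs_cmp (lrs_cmp (sch_hom p2) m) n')).
      rewrite hn'; have := congr1 (fun h => sch_hom (h \oc w)) (fibre_pi t).
      by rewrite -!cmpA.
    by rewrite pip; exact: lrs_hom_eq.
  subst n'.
  have [|s sE] := @site_lift _ _ _ _ _ p1 (fib1 t \oc w) (lrs_cmp m n).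
    by rewrite lrs_cmpA.
  exists s; split; first by move=> p; rewrite sE; exists (n p).
  apply: fibre_eq; apply: site_hom_ext.
    by transitivity (lrs_cmp (sch_hom p1) (sch_hom s)); rewrite // sE lrs_cmpA.
  by transitivity (lrs_cmp (sch_hom p2) (sch_hom s)); rewrite // sE lrs_cmpA.
- move=> T s s' sm s'm /(congr1 (fun h => fib1 h)) /= e.
  have [n nE] := open_immersion_factor om sm.
  have [n' n'E] := open_immersion_factor om s'm.
  apply: site_hom_ext; rewrite -nE -n'E; congr lrs_cmp.
  apply: (open_immersion_mono o1); rewrite -!lrs_cmpA nE n'E.
  by have := congr1 (fun h => sch_hom h) e.
- move=> U t T e s p bs [v _ vE]; split.
    have := congr1 (fun h : H T => sch_hom (fib1 h : hom T X) p) bs => /= <-.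
    by exists v => //=; rewrite vE.
  have := congr1 (fun h : H T => sch_hom (fib2 h : hom T X) p) bs => /= <-.
  by exists v => //=; rewrite vE.
Qed.

End Relation.
End RepresentedChart.

Lemma affine_finite_type_pull (k : comPzRingType) (S : noeth_sch k) (U : site S)
    (A : comPzRingType) (h : lrs_hom (Spec A) (sch U)) (nA : noetherian_ring A)
    (nS : noetherian_scheme (Spec A)) :
  local_open_immersion h -> locally_of finite_type_ring (sch_str U) ->
  affine_finite_type (pull_obj h nS).
Proof.
move=> hl fU; split.
  exists A, (lrs_id (Spec A)), (lrs_id (Spec A)).
  by split; exact: lrs_hom_eq.
split; first exact: locally_finite_type_cmp.
by move=> V _ _; exact: spec_noetherian_compact.
Qed.

(** * The affine presentation of a scheme of finite type, and the theorem *)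

Section Presentation.
Variables (k : comPzRingType) (S : noeth_sch k) (G : site S).
Hypothesis fG : finite_type (sch_str G).

(** An index [l] of a piece of [R] is a pair [(a, b)] with an affine open of the overlap [K (a, b)],
    seen inside piece [a]. The map [p1] includes it in piece [a], while [p2] sends it to piece [b]
    by [j2], obtained by factoring through the open immersion [f b]. *)
Lemma affine_presentation : exists (X R : site S) (pi : hom X G) (p1 p2 : hom R X),
  [/\ affine_finite_type X, affine_finite_type R & pi \oc p1 = pi \oc p2] /\
  [/\ local_open_immersion (sch_hom pi), forall g, range (sch_hom pi) g,
      forall r, exists (M : lrs) (m : lrs_hom M (sch R)),
        [/\ open_immersion m, range m r, open_immersion (lrs_cmp (sch_hom p1) m),
            open_immersion (lrs_cmp (sch_hom p2) m)
          & open_immersion (lrs_cmp (sch_hom (pi \oc p1)) m)]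
    & forall x y, sch_hom pi x = sch_hom pi y ->
        exists r, sch_hom p1 r = x /\ sch_hom p2 r = y].
Proof.
have [cG _] := site_noetherian G.
have [I [A [f [nA of_ fc _]]]] := finite_affine_cover (site_noetherian G) openT cG.
have [pi0 pi0E] := spec_dprod_glue f.
have nP := dprod_noetherian nA; have sP := spec_noetherian_scheme nP.
have pil : local_open_immersion pi0.
  by apply: glue_local_open_immersion => i; rewrite pi0E.
pose X := pull_obj pi0 sP; pose pi : hom X G := pull_hom pi0 sP.
have aX : affine_finite_type X by apply: affine_finite_type_pull => //; case: fG.
pose K (ab : I * I) := f ab.1 @^-1` range (f ab.2).
have /all_sig[J eJ] : forall ab, {J : finType | exists (B : J -> comPzRingType)
    (j : forall c, lrs_hom (Spec (B c)) (Spec (A ab.1))),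
    [/\ forall c, noetherian_ring (B c), forall c, open_immersion (j c),
        forall y, K ab y -> exists c, range (j c) y & forall c, range (j c) `<=` K ab]}.
  move=> ab; apply: cid; apply: finite_affine_cover.
  - exact: spec_noetherian_scheme.
  - by apply: lrs_continuous; exact: open_immersion_range.
  - exact: spec_noetherian_compact.
have /all_sig[B eB] := fun ab => cid (eJ ab).
have /all_sig[j jP] := fun ab => cid (eB ab).
pose L : finType := {ab : I * I & J ab}%type.
pose C (l : L) := B (tag l) (tagged l).
pose j1 (l : L) : lrs_hom (Spec (C l)) (Spec (A (tag l).1)) := j (tag l) (tagged l).
have oj1 l : open_immersion (j1 l) by have [_ oj _ _] := jP (tag l); exact: (oj (tagged l)).
have nC l : noetherian_ring (C l) by have [nB _ _ _] := jP (tag l); exact: (nB (tagged l)).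
have /all_sig[j2 j2E] : forall l : L, {j2 : lrs_hom (Spec (C l)) (Spec (A (tag l).2)) |
    lrs_cmp (f (tag l).2) j2 = lrs_cmp (f (tag l).1) (j1 l)}.
  move=> l; apply: cid; apply: open_immersion_factor => // c.
  have [_ _ _ jK] := jP (tag l).
  by apply: (jK (tagged l)); exists c.
have oj2 l : open_immersion (j2 l).
  by apply: (open_immersion_cancel (of_ (tag l).2)); rewrite j2E; exact: open_immersion_cmp.
have [p10 p10E] := spec_dprod_glue (fun l => lrs_cmp (dprod_incl A (tag l).1) (j1 l)).
have [p20 p20E] := spec_dprod_glue (fun l => lrs_cmp (dprod_incl A (tag l).2) (j2 l)).
have pi1 l : lrs_cmp (lrs_cmp pi0 p10) (dprod_incl C l) = lrs_cmp (f (tag l).1) (j1 l).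
  by rewrite -lrs_cmpA p10E lrs_cmpA pi0E.
have pi12 : lrs_cmp pi0 p10 = lrs_cmp pi0 p20.
  apply: (lrs_hom_cover_eq (@dprod_incl_open_immersion _ C) (@dprod_incl_cover _ C)) => l.
  by rewrite pi1 -lrs_cmpA p20E lrs_cmpA pi0E j2E.
have nQ := dprod_noetherian nC; have sQ := spec_noetherian_scheme nQ.
have o10 l : open_immersion (lrs_cmp p10 (dprod_incl C l)).
  by rewrite p10E; apply: open_immersion_cmp => //; exact: dprod_incl_open_immersion.
have o20 l : open_immersion (lrs_cmp p20 (dprod_incl C l)).
  by rewrite p20E; apply: open_immersion_cmp => //; exact: dprod_incl_open_immersion.
pose R := @pull_obj _ _ _ X p10 sQ; pose p1 : hom R X := @pull_hom _ _ _ X p10 sQ.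
have aR : affine_finite_type R.
  apply: affine_finite_type_pull => //; first exact: glue_local_open_immersion.
  by have [_ []] := aX.
(* [R] lies over [S] through [p1]; that [p20] is also a morphism over [S] follows from the equality
   of the two composites to [G]. *)
have [p2 p2E] := @site_lift _ _ R G X pi (pi \oc p1) p20 (esym pi12).
have pip : pi \oc p1 = pi \oc p2.
  apply: site_hom_ext; transitivity (lrs_cmp pi0 p20); first exact: pi12.
  by rewrite -p2E.
exists X, R, pi, p1, p2; split; split=> //.
- move=> g; have [i [x _ <-]] := fc g Logic.I; exists (dprod_incl A i x) => //.
  have [e _] := lrs_hom_eqP (pi0E i) x; exact: e.
- move=> r; have [l [z _ <-]] := dprod_incl_cover r.
  exists (Spec (C l)), (dprod_incl C l); split.
  + exact: dprod_incl_open_immersion.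
  + by exists z.
  + exact: o10.
  + by rewrite p2E.
  + rewrite [X in open_immersion X](_ : _ = lrs_cmp (f (tag l).1) (j1 l)); last exact: pi1.
    exact: open_immersion_cmp.
- move=> x y; have [a [x' _ <-]] := dprod_incl_cover x.
  have [b [y' _ <-]] := dprod_incl_cover y => xy.
  have [ea _] := lrs_hom_eqP (pi0E a) x'; have [eb _] := lrs_hom_eqP (pi0E b) y'.
  have fab : f a x' = f b y'.
    by transitivity (pi0 (dprod_incl A a x')) => //; rewrite -eb; exact: xy.
  have [_ _ jK _] := jP (a, b); have [|c [z _ zx]] := jK x'; first by exists y'.
  pose l : L := existT _ (a, b) c; exists (dprod_incl C l z); split.
    have [e _] := lrs_hom_eqP (p10E l) z; apply: (etrans e).
    by rewrite -zx.
  rewrite p2E; have [e _] := lrs_hom_eqP (p20E l) z; apply: (etrans e).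
  congr (dprod_incl A b _); apply: (open_immersion_inj (of_ b)).
  have [e' _] := lrs_hom_eqP (j2E l) z; apply: (etrans e').
  by rewrite -fab -zx.
Qed.

End Presentation.

Theorem corollary2p6 (k : comPzRingType) (hk : noetherian_ring k)
  (S : noeth_sch k) (F : group_sheaf S) (G : site S) :
  finite_type (sch_str G) -> represented_by (underlying F) G ->
  presentable_group_sheaf F.
Proof.
move=> fG [alpha [beta [alphaK betaK]]]; split; last exact: group_vertical.
have [X [R [pi [p1 [p2 [[aX aR pip] [pil pis Rl Rs]]]]]]] := affine_presentation fG.
have chX x : exists V D, chart (represented_hom alpha pi) V D /\ V x.
  have [M [m [om opm mx]]] := pil x.
  by exists (range m); eexists; split; first exact: (represented_chart alphaK betaK).
exists X, (represented_hom alpha pi); split=> //.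
- apply: chart_surjective => U t u; have [x _ xu] := pis (sch_hom (beta U t) u).
  have [M [m [om opm [v _ vx]]]] := pil x.
  exists (range m); eexists; split; first exact: (represented_chart alphaK betaK om opm).
  by exists v => //=; rewrite vx.
- exact: chart_vertical.
exists R, (relation_hom alpha pip); split=> //.
- apply: chart_surjective => U t u.
  have [|r [r1 r2]] := Rs (sch_hom (fib1 t) u) (sch_hom (fib2 t) u).
    by have := congr1 (fun h => sch_hom h u) (fibre_pi alphaK t).
  have [M [m [om [v _ vr] o1 o2 opm]]] := Rl r.
  exists (range m); eexists; split.
    exact: (relation_chart alphaK pip om o1 o2 opm).
  by split; exists v => //=; rewrite vr.
- apply: chart_vertical => r.
  have [M [m [om mr o1 o2 opm]]] := Rl r.
  by exists (range m); eexists; split; first exact: (relation_chart alphaK pip om o1 o2 opm).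
Qed.
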